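(* Let $p\in C^3((0,\infty),\mathbb{R})$ with $p'>0$, and write $c(\rho)=\sqrt{p'(\rho)}$. The Riemann problem for the isentropic Euler equations with pressure function $p$ and arbitrary sub-sonic left- and right-hand states is well-posed (i.e. for all sub-sonic $(\rho_l,q_l)$, $(\rho_r,q_r)$ there is exactly one $\rho>0$ with $L_l(\rho;\rho_l,q_l)=L_r(\rho;\rho_r,q_r)$) if $p$ satisfies the following conditions (C1), (C2), (C3): (C1) for all $\rho>0$: $2p'(\rho)+\rho p''(\rho)\ge 0$ and $6p'(\rho)+6\rho p''(\rho)+\rho^2p'''(\rho)\ge 0$; (C2) one of the following holds: (a) $p(\rho)\to\infty$ for $\rho\to\infty$; or (b) $p'(\rho)\le -\frac{p(\rho)}{\rho}$ for all $\rho>0$; (C3) one of the following holds: (a) there is $p_0>0$ such that $p(\rho)=-\frac{p_0}{\rho}+o\left(\frac1\rho\right)$ for $\rho\to0$; or (b) one of the following is fulfilled: (i) $\lim_{\rho\to0}c(\rho)=0$ and $2p'(\rho)-\rho p''(\rho)\ge0$ for all $\rho>0$; (ii) $0<\lim_{\rho\to0}c(\rho)<\infty$; (iii) there is $\eta\in(0,1)$ such that $\lim_{\rho\to0}\rho^{\eta}c(\rho)$ exists and $0<\lim_{\rho\to0}\rho^{\eta}c(\rho)<\infty$. These conditions are positively linear in $p$, and hence the set of all pressure functions satisfying them is a convex cone (it is closed under linear combinations with positive coefficients). In addition, because the integral is monotone and linear, one can also integrate over pressure functions satisfying these conditions (i.e. over a parametrised family of them, with respect to the parameter) to find new pressure 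functions.
   Context: Setting: the isentropic Euler equations without source term, $\rho_t+q_x=0$, $q_t+(p(\rho)+q^2/\rho)_x=0$, with density $\rho>0$, momentum $q\in\mathbb{R}$ and pressure function $p$ with $p'>0$. A state $(\rho,q)$ with $\rho>0$ is sub-sonic if $|q/\rho|<c(\rho)$, where $c(\rho)=\sqrt{p'(\rho)}$. For $\rho,\bar\rho>0$ let $f(\rho,\bar\rho)=\frac{\rho}{\bar\rho}(\rho-\bar\rho)\,(p(\rho)-p(\bar\rho))$. The Lax curves through $(\rho_l,q_l)$ and $(\rho_r,q_r)$ are the functions of $\rho>0$ $$L_l(\rho;\rho_l,q_l)=\begin{cases}\rho\left(\frac{q_l}{\rho_l}+\int_{\rho}^{\rho_l}\frac{c(s)}{s}\,ds\right)&\rho\le\rho_l,\\ \rho\frac{q_l}{\rho_l}-\sqrt{f(\rho,\rho_l)}&\rho\ge\rho_l,\end{cases}\qquad L_r(\rho;\rho_r,q_r)=\begin{cases}\rho\left(\frac{q_r}{\rho_r}-\int_{\rho}^{\rho_r}\frac{c(s)}{s}\,ds\right)&\rho\le\rho_r,\\ \rho\frac{q_r}{\rho_r}+\sqrt{f(\rho,\rho_r)}&\rho\ge\rho_r.\end{cases}$$ A solution of the Riemann problem with left state $(\rho_l,q_l)$ and right state $(\rho_r,q_r)$ is given by an intersection point $\rho>0$ of these curves; well-posedness means that there is exactly one such intersection point.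
   Formalization: For integrals over a family, derivatives up to order 3 are assumed locally dominated, and (C3) is claimed only under uniformity as ρ→0, since p_t=ρ^(1-t), t∈(0,1), integrates to a function violating (C3); C³, p'>0, (C1), (C2) and well-posedness need no uniformity. *)

(* Defs.v *)
From HB Require Import structures.
From mathcomp Require Import all_boot all_order all_algebra.
From mathcomp Require Import all_classical all_reals all_analysis.

Set Implicit Arguments.
Unset Strict Implicit.
Unset Printing Implicit Defensive.

Import Order.TTheory GRing.Theory Num.Theory.
Import numFieldNormedType.Exports.

Local Open Scope ring_scope.
Local Open Scope classical_set_scope.

(* A function on (0, oo) is represented by a function R -> R; nothing below
   depends on its values on (-oo, 0].  Since (0, oo) is open, the two-sided
   derivatives at x > 0 are those of the restriction. *)

Definition C3_on_pos (R : realType) (p : R -> R) : Prop :=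
  forall x : R, 0 < x ->
    (forall k : nat, (k < 3)%N -> derivable (derive1n k p) x 1) /\
    {for x, continuous (derive1n 3 p)}.

Definition pressure (R : realType) (p : R -> R) : Prop :=
  C3_on_pos p /\ (forall x : R, 0 < x -> 0 < derive1 p x).

Definition sound_speed (R : realType) (p : R -> R) (x : R) : R :=
  Num.sqrt (derive1 p x).

Definition subsonic (R : realType) (p : R -> R) (rho q : R) : Prop :=
  0 < rho /\ `|q / rho| < sound_speed p rho.

Definition shock_f (R : realType) (p : R -> R) (rho rhob : R) : R :=
  rho / rhob * (rho - rhob) * (p rho - p rhob).

Definition rarefaction_integral (R : realType) (p : R -> R) (x y : R) : R :=
  Rintegral (@lebesgue_measure R) `[x, y] (fun s => sound_speed p s / s).

Definition Lax_l (R : realType) (p : R -> R) (rhol ql rho : R) : R :=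
  if rho <= rhol then rho * (ql / rhol + rarefaction_integral p rho rhol)
  else rho * (ql / rhol) - Num.sqrt (shock_f p rho rhol).

Definition Lax_r (R : realType) (p : R -> R) (rhor qr rho : R) : R :=
  if rho <= rhor then rho * (qr / rhor - rarefaction_integral p rho rhor)
  else rho * (qr / rhor) + Num.sqrt (shock_f p rho rhor).

Definition Riemann_well_posed (R : realType) (p : R -> R) : Prop :=
  forall rhol ql rhor qr : R,
    subsonic p rhol ql -> subsonic p rhor qr ->
    exists! rho : R, 0 < rho /\ Lax_l p rhol ql rho = Lax_r p rhor qr rho.

Definition condC1 (R : realType) (p : R -> R) : Prop :=
  forall x : R, 0 < x ->
    0 <= 2 * derive1 p x + x * derive1n 2 p x /\
    0 <= 6 * derive1 p x + 6 * x * derive1n 2 p x + x ^+ 2 * derive1n 3 p x.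

Definition condC2 (R : realType) (p : R -> R) : Prop :=
  (p x @[x --> +oo%R] --> +oo%R) \/
  (forall x : R, 0 < x -> derive1 p x <= - (p x / x)).

Definition condC3a (R : realType) (p : R -> R) : Prop :=
  exists2 p0 : R, 0 < p0 &
    (fun x : R => p x - (- (p0 / x))) =o_ (0^'+) (fun x : R => x^-1).

Definition condC3b1 (R : realType) (p : R -> R) : Prop :=
  (sound_speed p x @[x --> 0^'+] --> (0 : R)) /\
  (forall x : R, 0 < x -> 0 <= 2 * derive1 p x - x * derive1n 2 p x).

Definition condC3b2 (R : realType) (p : R -> R) : Prop :=
  exists2 l : R, 0 < l & sound_speed p x @[x --> 0^'+] --> l.

Definition sound_speed_order (R : realType) (p : R -> R) (eta : R) : Prop :=
  exists2 l : R, 0 < l & x `^ eta * sound_speed p x @[x --> 0^'+] --> l.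

Definition condC3b3 (R : realType) (p : R -> R) : Prop :=
  exists2 eta : R, 0 < eta < 1 & sound_speed_order p eta.

Definition condC3 (R : realType) (p : R -> R) : Prop :=
  condC3a p \/ [\/ condC3b1 p, condC3b2 p | condC3b3 p].

Definition admissible (R : realType) (p : R -> R) : Prop :=
  [/\ pressure p, condC1 p, condC2 p & condC3 p].

Definition convex_cone (R : realType) (K : set (R -> R)) : Prop :=
  forall (a b : R) (p1 p2 : R -> R), 0 < a -> 0 < b -> K p1 -> K p2 ->
    K (fun x => a * p1 x + b * p2 x).

Definition integral_pressure (R : realType) (d : measure_display)
    (T : measurableType d) (mu : {measure set T -> \bar R})
    (p : T -> R -> R) (x : R) : R :=
  Rintegral mu setT (fun t => p t x).

(* The usual hypotheses for differentiating three times under the integral: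
   integrability in the parameter, and derivatives dominated locally uniformly
   in the density. *)
Definition integrable_family (R : realType) (d : measure_display)
    (T : measurableType d) (mu : {measure set T -> \bar R})
    (p : T -> R -> R) : Prop :=
  (forall x : R, 0 < x -> mu.-integrable setT (fun t => (p t x)%:E)) /\
  (forall (k : nat) (a b : R), (0 < k <= 3)%N -> 0 < a -> a < b ->
     exists2 g : T -> R, mu.-integrable setT (fun t => (g t)%:E) &
       forall (t : T) (x : R), a <= x <= b -> `|derive1n k (p t) x| <= g t).

(* The pointwise limits in (C3) do not pass through an integral without some
   uniformity at vacuum: for p t x = x `^ (1 - t), t uniform in (0, 1), each
   member satisfies (C3) with eta = t / 2 but the integral (x - 1) / ln x
   satisfies no alternative of (C3).  Either alternative (a) holds on a
   non-null set of parameters, or some rate eta, attained on a non-null set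
   unless eta = 0, dominates c(rho)^2 = p'(rho) near 0.  A family over
   finitely many points of positive finite mass always qualifies. *)
Definition uniform_at_vacuum (R : realType) (d : measure_display)
    (T : measurableType d) (mu : {measure set T -> \bar R})
    (p : T -> R -> R) : Prop :=
  ~ mu.-negligible [set t | condC3a (p t)] \/
  exists eta : R, [/\ 0 <= eta < 1,
    exists2 g : T -> R, mu.-integrable setT (fun t => (g t)%:E) &
      forall (t : T) (x : R), 0 < x <= 1 ->
        x `^ (2 * eta) * derive1 (p t) x <= g t &
    eta = 0 \/ ~ mu.-negligible [set t | sound_speed_order (p t) eta]].

(* Main.v *)
Require Import Defs.
From mathcomp Require Import all_boot all_order all_algebra.
From mathcomp Require Import all_classical all_reals all_analysis.
From mathcomp Require Import measurable_realfun ring lra.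

Set Implicit Arguments.
Unset Strict Implicit.
Unset Printing Implicit Defensive.
Import Order.TTheory GRing.Theory Num.Theory.
Import numFieldNormedType.Exports.

Local Open Scope ring_scope.
Local Open Scope classical_set_scope.

(** Divided by rho, the Lax curves through (rho_l, q_l) and (rho_r, q_r) are
    u_l - w_l and u_r + w_r, where u = q / rho is the velocity and w_l, w_r
    are continuous, strictly increasing functions of rho that vanish at the
    base densities ([wave]).  The Riemann problem asks for a root of
    w_l + w_r = u_l - u_r, so there is at most one, and by the intermediate
    value theorem there is one as soon as each w exceeds every y < c and falls
    below every y > - c, because u_l and - u_r lie strictly between - c and c.

    Everything becomes transparent in the specific volume v = 1 / rho.  Put
    G = - dp/dv = rho^2 p'(rho) = (rho c)^2, the squared acoustic impedance.
    The first half of (C1) says that p is convex in v, i.e. that G is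
    nondecreasing in rho.
    - Large densities: the tangent to the convex function p(v) at 1 / r gives
      w(x) >= (1 - r / x) c(r), which tends to c(r) ([wave_exceeds]).
    - Small densities: w(0+) = - int_0^r c(s)/s ds, so what is needed is that
      int_0^r c(s)/s ds >= c(r) for all r ([vacuum_reachable]).  In all
      alternatives of (C3) except (b)(i), c is bounded below near 0 and the
      integral diverges; in (b)(i) the quotient c(s)/s is nonincreasing,
      which gives the bound directly ([vacuum_reachable_of_C3]).

    For the cone and integral statements, the alternatives of (C3) are
    rewritten as limits that are linear in p: (a) says that rho p(rho) has a
    negative limit at 0, or equivalently, under (C1), that rho^2 p'(rho) has a
    positive one, and (b)(ii), (b)(iii) say that rho^(2 eta) p'(rho) has a
    positive limit for some eta in [0, 1), with eta = 0 for (ii).  Sums then only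
    require comparing exponents, and integrals require dominated convergence.
    For (C2), a bounded integrated pressure forces, by monotone convergence,
    almost every member of the family to be bounded.

    Well-posedness for an integrated pressure P does not pass through (C3),
    which may fail for P, but through [vacuum_reachable].  In the variable v
    this condition reads int_(1/r)^oo sqrt(G) dv >= sqrt(G(1/r)) / r.  The
    square of the right side is linear in G, while the square of the left side
    is superadditive in G: this is the reverse Minkowski inequality for the
    exponent 1/2.  Hence the condition is inherited by P
    ([vacuum_reachable_integral]).  The exchange of integrals is done on upper
    Riemann sums over a uniform grid in v, where it only involves finite sums;
    monotonicity of G controls the discretisation error, and Fatou's lemma
    gives the limit. *)

(** * Calculus on the half-line *)

Section Calculus.
Context {R : realType}.
Implicit Types (f df : R -> R) (a b x y : R).

Lemma is_derive_continuous f (d : R) x : is_derive x 1 f d -> {for x, continuous f}.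
Proof. by move=> [? _]; apply/differentiable_continuous/derivable1_diffP. Qed.

Lemma is_derive_mean_value f df a b : a < b ->
  (forall x, a <= x <= b -> is_derive x 1 f (df x)) ->
  exists2 c, a < c < b & f b - f a = df c * (b - a).
Proof.
move=> ab fdf.
have [||c] := @MVT R f df a b ab; last by rewrite in_itv /=; exists c.
- by move=> x; rewrite in_itv /= => /andP[ax xb]; apply: fdf; rewrite !ltW.
- apply: derivable_within_continuous => x; rewrite in_itv /= => /fdf.
  by case.
Qed.

Lemma is_derive_ge0_le f df a b : a <= b ->
  (forall x, a <= x <= b -> is_derive x 1 f (df x)) ->
  (forall x, a <= x <= b -> 0 <= df x) -> f a <= f b.
Proof.
rewrite le_eqVlt => /predU1P[-> //|ab] fdf df0.
have [c /andP[ac cb] fE] := is_derive_mean_value ab fdf.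
by rewrite -subr_ge0 fE mulr_ge0 ?subr_ge0 ?df0 ?(ltW ab)// !ltW.
Qed.

Lemma is_derive_gt0_lt f df a b : a < b ->
  (forall x, a <= x <= b -> is_derive x 1 f (df x)) ->
  (forall x, a <= x <= b -> 0 < df x) -> f a < f b.
Proof.
move=> ab fdf df0.
have [c /andP[ac cb] fE] := is_derive_mean_value ab fdf.
by rewrite -subr_gt0 fE mulr_gt0 ?subr_gt0 ?df0 // !ltW.
Qed.

Lemma is_derive_add f g (a b x : R) : is_derive x 1 f a -> is_derive x 1 g b ->
  is_derive x 1 (fun y => f y + g y) (a + b).
Proof. exact: is_deriveD. Qed.

Lemma is_derive_opp f (a x : R) : is_derive x 1 f a ->
  is_derive x 1 (fun y => - f y) (- a).
Proof. exact: is_deriveN. Qed.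

Lemma is_derive_mul f g (a b x : R) : is_derive x 1 f a -> is_derive x 1 g b ->
  is_derive x 1 (fun y => f y * g y) (a * g x + f x * b).
Proof.
move=> fa gb; apply: (is_derive_eq (is_deriveM fa gb)).
by rewrite /GRing.scale /= addrC mulrC.
Qed.

Lemma is_derive_scale f (k a x : R) : is_derive x 1 f a ->
  is_derive x 1 (fun y => k * f y) (k * a).
Proof. exact: is_deriveZ. Qed.

Lemma is_derive_sqr (x : R) : is_derive x 1 (fun y => y ^+ 2) (2 * x).
Proof.
have /is_derive_eq := is_derive_mul (is_derive_id x 1) (is_derive_id x 1).
by apply; rewrite mul1r mulr1 mulr_natl mulr2n.
Qed.

Lemma is_derive_inv (x : R) : 0 < x -> is_derive x 1 (fun y => y^-1) (- x ^- 2).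
Proof.
move=> x0; have xn : x != 0 by rewrite gt_eqF.
apply: is_derive_eq; first exact: (is_deriveV (f := id) xn (is_derive_id x 1)).
by rewrite /GRing.scale /= mulr1.
Qed.

(** Derivatives are local, so functions that agree on the open half-line have
    the same derivatives there. *)
Lemma derive1n_eq_pos (f g : R -> R) (n : nat) : (forall x, 0 < x -> f x = g x) ->
  forall x, 0 < x -> derive1n n f x = derive1n n g x.
Proof.
move=> fg; elim: n => [|n IH] x x0; first exact: fg.
rewrite !derive1nS !derive1E; apply: near_eq_derive.
by near=> y; apply: IH; near: y; exact: lt_nbhsr.
Unshelve. all: by end_near. Qed.

Lemma derivable_eq_pos (f g : R -> R) : (forall x, 0 < x -> f x = g x) ->
  forall x, 0 < x -> derivable f x 1 -> derivable g x 1.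
Proof.
move=> fg x x0; apply: near_eq_derivable.
by near=> y; apply: fg; near: y; exact: lt_nbhsr.
Unshelve. all: by end_near. Qed.

Lemma continuous_eq_pos (f g : R -> R) x : (forall y, 0 < y -> f y = g y) -> 0 < x ->
  {for x, continuous f} -> {for x, continuous g}.
Proof.
move=> fg x0 cf; change (g y @[y --> x] --> g x); rewrite -(fg x x0).
apply: cvg_trans cf.
apply: near_eq_cvg; near=> y; apply: fg; near: y; exact: lt_nbhsr.
Unshelve. all: by end_near. Qed.

End Calculus.

(** * The pressure and the rarefaction integral *)

Section SoundSpeed.
Context {R : realType} (p : R -> R) (pp : pressure p).
Implicit Types x y a b r : R.
Local Notation c := (sound_speed p).
Local Notation rar := (rarefaction_integral p).

Lemma derive1n_is_derive (k : nat) x : (k < 3)%N -> 0 < x ->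
  is_derive x 1 (derive1n k p) (derive1n k.+1 p x).
Proof.
move=> k3 x0; apply: DeriveDef; first by have [/(_ x x0)[+ _] _] := pp; apply.
by rewrite derive1nS derive1E.
Qed.

Lemma pressure_is_derive x : 0 < x -> is_derive x 1 p (derive1 p x).
Proof. exact: (@derive1n_is_derive 0). Qed.

Lemma dpressure_is_derive x : 0 < x ->
  is_derive x 1 (derive1 p) (derive1n 2 p x).
Proof. exact: (@derive1n_is_derive 1). Qed.

Lemma dpressure_gt0 x : 0 < x -> 0 < derive1 p x.
Proof. by case: pp => _; exact. Qed.

Lemma sound_speed_gt0 x : 0 < x -> 0 < c x.
Proof. by move=> x0; rewrite sqrtr_gt0 dpressure_gt0. Qed.

Lemma sqr_sound_speed x : 0 < x -> c x ^+ 2 = derive1 p x.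
Proof. by move=> x0; rewrite sqr_sqrtr// ltW// dpressure_gt0. Qed.

Lemma pressure_lt x y : 0 < x -> x < y -> p x < p y.
Proof.
move=> x0 xy; apply: (is_derive_gt0_lt (df := derive1 p)) => // z /andP[xz _].
  by apply: pressure_is_derive; rewrite (lt_le_trans x0).
by apply: dpressure_gt0; rewrite (lt_le_trans x0).
Qed.

Lemma pressure_le x y : 0 < x -> x <= y -> p x <= p y.
Proof.
by move=> x0; rewrite le_eqVlt => /predU1P[->//|/(pressure_lt x0)/ltW].
Qed.

Lemma sound_speed_continuous x : 0 < x -> {for x, continuous c}.
Proof.
move=> x0; apply: (@continuous_comp _ _ _ (derive1 p) Num.sqrt).
  exact/is_derive_continuous/dpressure_is_derive.
exact: sqrt_continuous.
Qed.

Lemma rarefaction_integrand_continuous x : 0 < x ->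
  {for x, continuous (fun s => c s / s)}.
Proof.
move=> x0; apply: cvgM; first exact: sound_speed_continuous.
exact/is_derive_continuous/is_derive_inv.
Qed.

Lemma rarefaction_integrable a b : 0 < a ->
  (@lebesgue_measure R).-integrable `[a, b] (EFin \o (fun s => c s / s)).
Proof.
move=> a0; apply: continuous_compact_integrable; first exact: segment_compact.
apply: continuous_in_subspaceT => x; rewrite inE /= in_itv /= => /andP[ax _].
by apply: rarefaction_integrand_continuous; rewrite (lt_le_trans a0).
Qed.

Lemma rarefaction_integralD a b r : 0 < a -> a <= b -> b <= r ->
  rar a r = rar a b + rar b r.
Proof.
move=> a0 ab br; apply/eqP; rewrite addrC -subr_eq; apply/eqP.
rewrite /rarefaction_integral Rintegral_itvB ?bnd_simp//; last first.
  exact: rarefaction_integrable.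
apply: Rintegral_itv_obnd_cbnd.
apply: (integrableS _ _ _ (rarefaction_integrable r (lt_le_trans a0 ab))) => //.
by apply: subset_itv; rewrite bnd_simp.
Qed.

(** A primitive of c(s)/s on the whole half-line, which turns rarefaction
    integrals into differences. *)
Definition rarefaction_primitive x : R :=
  if 1 <= x then rar 1 x else - rar x 1.
Local Notation K := rarefaction_primitive.

Lemma rarefaction_integralE a b : 0 < a -> a <= b -> rar a b = K b - K a.
Proof.
move=> a0 ab; rewrite /K; case: leP => b1; case: leP => a1.
- by have := rarefaction_integralD ltr01 a1 ab; lra.
- by have := rarefaction_integralD a0 (ltW a1) b1; lra.
- by have := lt_le_trans b1 (le_trans a1 ab); rewrite ltxx.
- by have := rarefaction_integralD a0 ab (ltW b1); lra.
Qed.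

(** On a compact neighbourhood of x, this is the fundamental theorem of
    calculus, with x / 2 as the base point of the integral. *)
Lemma rarefaction_primitive_is_derive x : 0 < x -> is_derive x 1 K (c x / x).
Proof.
move=> x0; have a0 : 0 < x / 2 by rewrite divr_gt0.
have ax : x / 2 < x by rewrite ltr_pdivrMr// ltr_pMr// ltr1n.
have [dF F'] := continuous_FTC1_closed (ltr_pwDr ltr01 (lexx x))
  (rarefaction_integrable _ a0) ax (rarefaction_integrand_continuous x0).
apply: (@near_eq_is_derive _ _ _ (fun y => rar (x / 2) y + K (x / 2))).
  near=> y; rewrite rarefaction_integralE ?subrK//.
  by apply: ltW; near: y; exact: lt_nbhsr.
rewrite -[c x / x]addr0; apply: is_derive_add.
apply: DeriveDef; first exact: dF.
by rewrite -derive1E; exact: F'.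
Unshelve. all: by end_near. Qed.

Lemma rarefaction_primitive_le a b : 0 < a -> a <= b -> K a <= K b.
Proof.
move=> a0 ab; apply: (is_derive_ge0_le (df := fun s => c s / s)) => //.
  move=> x /andP[ax _]; apply: rarefaction_primitive_is_derive.
  exact: lt_le_trans ax.
by move=> x /andP[ax _]; rewrite divr_ge0 ?sqrtr_ge0// (le_trans (ltW a0)).
Qed.

Lemma rarefaction_primitive_lt a b : 0 < a -> a < b -> K a < K b.
Proof.
move=> a0 ab; apply: (is_derive_gt0_lt (df := fun s => c s / s)) => //.
  move=> x /andP[ax _]; apply: rarefaction_primitive_is_derive.
  exact: lt_le_trans ax.
move=> x /andP[ax _]; have x0 := lt_le_trans a0 ax.
by rewrite divr_gt0 ?sound_speed_gt0.
Qed.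

Hypothesis C1 : forall x, 0 < x -> 0 <= 2 * derive1 p x + x * derive1n 2 p x.

(** The derivative of x^2 p'(x) is x (2 p'(x) + x p''(x)). *)
Lemma sqr_impedance_nondecreasing a b : 0 < a -> a <= b ->
  a ^+ 2 * derive1 p a <= b ^+ 2 * derive1 p b.
Proof.
move=> a0 ab; apply: (is_derive_ge0_le (f := fun x => x ^+ 2 * derive1 p x)
  (df := fun x => x * (2 * derive1 p x + x * derive1n 2 p x))) => //.
- move=> x /andP[/(lt_le_trans a0) x0 _].
  apply: is_derive_eq.
    exact: is_derive_mul (is_derive_sqr x) (dpressure_is_derive x0).
  by rewrite /=; ring.
- move=> x /andP[/(lt_le_trans a0) x0 _].
  exact: mulr_ge0 (ltW x0) (C1 x0).
Qed.

Lemma impedance_nondecreasing a b : 0 < a -> a <= b -> a * c a <= b * c b.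
Proof.
move=> a0 ab; have b0 := lt_le_trans a0 ab.
rewrite -ler_sqr ?nnegrE ?mulr_ge0 ?sqrtr_ge0 ?(ltW a0) ?(ltW b0)//.
by rewrite !exprMn !sqr_sound_speed// sqr_impedance_nondecreasing.
Qed.

(** In the variable v = 1 / x, where p is convex with slope - r^2 p'(r) at
    v = 1 / r, this is the inequality between p and its tangent. *)
Lemma pressure_tangent r x : 0 < r -> r <= x ->
  (1 - r / x) * (r * derive1 p r) <= p x - p r.
Proof.
move=> r0 rx; have x0 := lt_le_trans r0 rx.
(* x p'(x) + p(x) is nondecreasing by (C1), and it is the derivative of x p(x). *)
have h_nd y : r <= y -> p r + r * derive1 p r <= p y + y * derive1 p y.
  move=> ry; apply: (is_derive_ge0_le (f := fun z => p z + z * derive1 p z)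
    (df := fun z => 2 * derive1 p z + z * derive1n 2 p z)) => // z /andP[rz _].
    have z0 := lt_le_trans r0 rz; apply: is_derive_eq.
      apply: is_derive_add (pressure_is_derive z0) _.
      exact: is_derive_mul (is_derive_id z 1) (dpressure_is_derive z0).
    by rewrite /=; ring.
  exact/C1/(lt_le_trans r0).
have F : r * p r - (p r + r * derive1 p r) * r
         <= x * p x - (p r + r * derive1 p r) * x.
  apply: (is_derive_ge0_le (f := fun y => y * p y - (p r + r * derive1 p r) * y)
   (df := fun y => (p y + y * derive1 p y) - (p r + r * derive1 p r)) rx).
    move=> y /andP[ry _]; have y0 := lt_le_trans r0 ry.
    have dyp := is_derive_mul (is_derive_id y 1) (pressure_is_derive y0).
    have dky := is_derive_scale (p r + r * derive1 p r) (is_derive_id y 1).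
    apply: (is_derive_eq (is_derive_add dyp (is_derive_opp dky))).
    by rewrite /=; ring.
  by move=> y /andP[ry _]; rewrite subr_ge0 h_nd.
rewrite -(ler_pM2l x0).
have -> : x * ((1 - r / x) * (r * derive1 p r)) = (x - r) * (r * derive1 p r).
  by field; rewrite gt_eqF.
by move: F; lra.
Qed.

End SoundSpeed.

(** * Lax curves as monotone waves *)

Section WaveCurves.
Context {R : realType} (p : R -> R) (pp : pressure p).
Implicit Types x y a b r : R.
Local Notation c := (sound_speed p).
Local Notation rar := (rarefaction_integral p).
Local Notation K := (rarefaction_primitive p).

(** The change of velocity along a Lax curve based at the density r, signed so
    that it increases with x: negative on the rarefaction branch x <= r and
    positive on the shock branch. *)
Definition wave r x : R :=
  if x <= r then - rar x r
  else Num.sqrt ((r^-1 - x^-1) * (p x - p r)).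

Lemma shock_fE r x : 0 < r -> 0 < x ->
  Num.sqrt (shock_f p x r) = x * Num.sqrt ((r^-1 - x^-1) * (p x - p r)).
Proof.
move=> r0 x0; have -> : shock_f p x r = x ^+ 2 * ((r^-1 - x^-1) * (p x - p r)).
  by rewrite /shock_f; field; rewrite !gt_eqF.
by rewrite sqrtrM ?sqr_ge0// sqrtr_sqr gtr0_norm.
Qed.

Lemma Lax_lE r q x : 0 < r -> 0 < x -> Lax_l p r q x = x * (q / r - wave r x).
Proof.
move=> r0 x0; rewrite /Lax_l /wave; case: ifP => _; first by rewrite opprK.
by rewrite shock_fE// [RHS]mulrBr.
Qed.

Lemma Lax_rE r q x : 0 < r -> 0 < x -> Lax_r p r q x = x * (q / r + wave r x).
Proof.
move=> r0 x0; rewrite /Lax_r /wave; case: ifP => _ //.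
by rewrite shock_fE// [RHS]mulrDr.
Qed.

Lemma wave_rarefaction r x : 0 < x -> x <= r -> wave r x = K x - K r.
Proof. by move=> x0 xr; rewrite /wave xr rarefaction_integralE// opprB. Qed.

Lemma wave_shock r x : 0 < r -> r <= x ->
  wave r x = Num.sqrt ((r^-1 - x^-1) * (p x - p r)).
Proof.
rewrite le_eqVlt => r0 /predU1P[<-|rx]; last by rewrite /wave leNgt rx.
by rewrite wave_rarefaction// !subrr mul0r sqrtr0.
Qed.

Lemma wave_lt r x y : 0 < r -> 0 < x -> x < y -> wave r x < wave r y.
Proof.
move=> r0 x0 xy; have y0 := lt_trans x0 xy.
have rarefaction_lt a b : 0 < a -> a < b -> b <= r -> wave r a < wave r b.
  move=> a0 ab br; have b0 := lt_trans a0 ab.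
  rewrite !wave_rarefaction// ?(le_trans (ltW ab))//.
  by rewrite ltrD2r rarefaction_primitive_lt.
have shock_lt a b : r <= a -> a < b -> wave r a < wave r b.
  move=> ra ab; have rb := le_lt_trans ra ab.
  have a0 := lt_le_trans r0 ra; have b0 := lt_trans a0 ab.
  have iab : b^-1 < a^-1 by rewrite ltf_pV2.
  have iar : a^-1 <= r^-1 by rewrite lef_pV2.
  have pra := pressure_le pp r0 ra; have pab := pressure_lt pp a0 ab.
  rewrite !wave_shock// ?(ltW rb)// ltr_sqrt.
    by apply: ltr_pM; rewrite ?subr_ge0 ?ltrD2l ?ltrD2r ?ltrN2.
  by rewrite mulr_gt0// subr_gt0 ?(lt_le_trans iab)// (le_lt_trans pra).
have [yr|ry] := leP y r; first exact: rarefaction_lt.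
have [rx|xr] := leP r x; first exact: shock_lt.
exact: lt_trans (rarefaction_lt _ _ x0 xr (lexx r)) (shock_lt _ _ (lexx r) ry).
Qed.

(** Both branches vanish at x = r, so clamping the argument of each branch at r
    and adding removes the case distinction; continuity then follows by
    composition. *)
Lemma wave_min_max r x : 0 < r -> 0 < x ->
  wave r x = (K (Num.min x r) - K r) +
    Num.sqrt ((r^-1 - (Num.max x r)^-1) * (p (Num.max x r) - p r)).
Proof.
move=> r0 x0; have [xr|/ltW rx] := leP x r.
  by rewrite wave_rarefaction// !subrr mul0r sqrtr0 addr0.
by rewrite wave_shock// subrr add0r.
Qed.

Lemma wave_continuous r x : 0 < r -> 0 < x -> {for x, continuous (wave r)}.
Proof.
move=> r0 x0.
pose s y := (r^-1 - y^-1) * (p y - p r).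
pose g y := (K (Num.min y r) - K r) + Num.sqrt (s (Num.max y r)).
have gw : {near x, g =1 wave r}.
  by near=> y; rewrite wave_min_max//; near: y; exact: lt_nbhsr.
apply: (cvg_trans (near_eq_cvg gw)).
rewrite -(nbhs_singleton gw).
have m0 : 0 < Num.min x r by rewrite lt_min x0.
have M0 : 0 < Num.max x r by rewrite lt_max x0.
have cmin : {for x, continuous (fun y : R => Num.min y r)}.
  apply: (@continuous_min _ _ id (cst r)); [exact: cvg_id|exact: cvg_cst].
have cmax : {for x, continuous (fun y : R => Num.max y r)}.
  apply: (@continuous_max _ _ id (cst r)); [exact: cvg_id|exact: cvg_cst].
have cs : {for Num.max x r, continuous s}.
  apply: cvgM; apply: cvgB; try exact: cvg_cst.
    exact/is_derive_continuous/is_derive_inv.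
  exact/is_derive_continuous/pressure_is_derive.
apply: cvgD.
  apply: cvgB; last exact: cvg_cst.
  apply: (@continuous_comp _ _ _ (fun y => Num.min y r) K) => //.
  exact/is_derive_continuous/rarefaction_primitive_is_derive.
apply: (@continuous_comp _ _ _ (fun y => s (Num.max y r)) Num.sqrt).
  exact: (@continuous_comp _ _ _ (fun y => Num.max y r) s).
exact: sqrt_continuous.
Unshelve. all: by end_near. Qed.

(** int_0^r c(s)/s ds >= c(r) for every r, without the improper integral:
    the velocity that a gas can gain by rarefaction towards vacuum is at least
    its sound speed. *)
Definition vacuum_reachable := forall r y, 0 < r -> y < c r ->
  exists2 a, 0 < a < r & y < rar a r.

Hypothesis C1 : forall x, 0 < x -> 0 <= 2 * derive1 p x + x * derive1n 2 p x.

(** Inserting [pressure_tangent] under the square root of the shock branch gives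
    (1 - r / x) c(r) as a lower bound for the wave, and this tends to c(r). *)
Lemma wave_exceeds r y : 0 < r -> y < c r -> exists2 x, 0 < x & y < wave r x.
Proof.
move=> r0 yc; have c0 : 0 < c r by exact: sound_speed_gt0.
have wave_ge x : r <= x -> (1 - r / x) * c r <= wave r x.
  move=> rx; have x0 := lt_le_trans r0 rx.
  have rx1 : 0 <= 1 - r / x by rewrite subr_ge0 ler_pdivrMr// mul1r.
  rewrite wave_shock// -[leLHS]ger0_norm ?mulr_ge0 ?(ltW c0)// -sqrtr_sqr.
  apply: ler_wsqrtr; rewrite exprMn sqr_sound_speed//.
  have -> : (1 - r / x) ^+ 2 * derive1 p r
      = (r^-1 - x^-1) * ((1 - r / x) * (r * derive1 p r)).
    by field; rewrite !gt_eqF.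
  by rewrite ler_wpM2l ?subr_ge0 ?lef_pV2// pressure_tangent.
have [y0|y0] := leP y 0.
  exists (2 * r); first by rewrite mulr_gt0.
  apply: (lt_le_trans _ (wave_ge _ _)); last by rewrite ler_pMl// ler1n.
  apply: (le_lt_trans y0); rewrite mulr_gt0// subr_gt0 ltr_pdivrMr ?mulr_gt0//.
  by rewrite mul1r ltr_pMl// ltr1n.
(* For this x, (1 - r / x) c(r) is the midpoint of y and c(r). *)
pose x := r * (2 * c r / (c r - y)).
have cy0 : 0 < c r - y by rewrite subr_gt0.
exists x; first by rewrite !mulr_gt0 ?invr_gt0.
apply: (lt_le_trans _ (wave_ge _ _)); last first.
  rewrite ler_peMr ?(ltW r0)// ler_pdivlMr//; lra.
have -> : (1 - r / x) * c r = (c r + y) / 2.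
  by rewrite /x; field; rewrite !gt_eqF.
by lra.
Qed.

Hypothesis vac : vacuum_reachable.

(** The densities at which the two waves separately exceed u_l and - u_r, and
    those at which they fall below, are combined by maximum and minimum, since
    both waves are increasing. *)
Lemma Riemann_well_posed_of_vacuum_reachable : Riemann_well_posed p.
Proof.
move=> rl ql rr qr [rl0 subl] [rr0 subr].
have /andP[l1 l2] : - c rl < ql / rl < c rl by rewrite -ltr_norml.
have /andP[r1 r2] : - c rr < qr / rr < c rr by rewrite -ltr_norml.
pose F x := wave rl x + wave rr x; pose D := ql / rl - qr / rr.
have Flt x y : 0 < x -> x < y -> F x < F y.
  by move=> x0 xy; apply: ltrD; exact: wave_lt.
have Fle x y : 0 < x -> x <= y -> F x <= F y.
  by move=> x0; rewrite le_eqVlt => /predU1P[->//|/(Flt _ _ x0)/ltW].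
have wave_le r x y : 0 < r -> 0 < x -> x <= y -> wave r x <= wave r y.
  by move=> r0 x0; rewrite le_eqVlt => /predU1P[->//|/(wave_lt r0 x0)/ltW].
have LaxE x : 0 < x -> Lax_l p rl ql x = Lax_r p rr qr x <-> F x = D.
  move=> x0; rewrite Lax_lE// Lax_rE//; rewrite /F /D; split.
    by move=> /(mulfI (lt0r_neq0 x0)); lra.
  by move=> FD; congr (_ * _); lra.
have rarefaction_lt r y : 0 < r -> - c r < y -> exists2 x, 0 < x & wave r x < y.
  rewrite ltrNl => r0 /(vac r0)[x /andP[x0 xr] yx]; exists x => //.
  by rewrite /wave (ltW xr) ltrNl.
have [a1 a10 Fa1] := rarefaction_lt rl (ql / rl) rl0 l1.
have [|a2 a20 Fa2] := rarefaction_lt rr (- (qr / rr)) rr0; first by rewrite ltrN2.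
have [b1 b10 Fb1] := wave_exceeds rl0 l2.
have [|b2 b20 Fb2] := @wave_exceeds rr (- (qr / rr)) rr0.
  by rewrite ltrNl.
pose a := Num.min a1 a2; pose b := Num.max b1 b2.
have a0 : 0 < a by rewrite lt_min a10.
have b0 : 0 < b by rewrite lt_max b10.
have Fa : F a < D.
  rewrite /F /D; apply: ltrD.
    by apply: le_lt_trans Fa1; rewrite wave_le// ge_min lexx.
  by apply: le_lt_trans Fa2; rewrite wave_le// ge_min lexx orbT.
have Fb : D < F b.
  rewrite /F /D; apply: ltrD.
    by apply: (lt_le_trans Fb1); rewrite wave_le// le_max lexx.
  by apply: (lt_le_trans Fb2); rewrite wave_le// le_max lexx orbT.
have ab : a <= b.
  by rewrite leNgt; apply/negP => /ltW /(Fle _ _ b0); rewrite leNgt (lt_trans Fa).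
have cF : {within `[a, b], continuous F}.
  apply: continuous_in_subspaceT => x; rewrite inE /= in_itv /= => /andP[ax _].
  have x0 := lt_le_trans a0 ax.
  by apply: cvgD; exact: wave_continuous.
have [|x] := @IVT R F a b D ab cF.
  by rewrite ge_min le_max (ltW Fa) (ltW Fb) orbT.
rewrite in_itv /= => /andP[ax _] Fx; have x0 := lt_le_trans a0 ax.
exists x; split; first by split => //; exact/LaxE.
move=> y [y0 /(LaxE _ y0) Fy].
have [xy|yx|//] := ltgtP x y.
  by have := Flt _ _ x0 xy; rewrite Fx Fy ltxx.
by have := Flt _ _ y0 yx; rewrite Fx Fy ltxx.
Qed.

End WaveCurves.

(** * Behaviour at vacuum *)

Section Vacuum.
Context {R : realType}.
Implicit Types (f p : R -> R) (x y L eta : R).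

Lemma at_right0P (P : set R) :
  (\forall x \near 0^'+, P x) <-> exists2 e : R, 0 < e & forall x, 0 < x <= e -> P x.
Proof.
split => [[e /= e0 eP]|[e e0 eP]].
  exists (e / 2); first by rewrite divr_gt0.
  move=> x /andP[x0 xe]; apply: eP => //=; rewrite sub0r normrN gtr0_norm//.
  by rewrite (le_lt_trans xe)// ltr_pdivrMr// ltr_pMr// ltr1n.
near=> x; apply: eP; apply/andP; split; near: x; first exact: nbhs_right_gt.
exact: nbhs_right_le.
Unshelve. all: by end_near. Qed.

Lemma cvg_eq_right0 f (g : R -> R) L : (forall x, 0 < x -> f x = g x) ->
  f x @[x --> 0^'+] --> L -> g x @[x --> 0^'+] --> L.
Proof.
move=> fg; apply: cvg_trans; apply: near_eq_cvg.
by near=> x; apply: fg; near: x; exact: nbhs_right_gt.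
Unshelve. all: by end_near. Qed.

Lemma littleo_invx_cvg f L :
  (fun x => f x - (- (L / x))) =o_ (0^'+) (fun x : R => x^-1) <->
  x * f x @[x --> 0^'+] --> - L.
Proof.
have normE x : 0 < x -> `|- L - x * f x| = x * `|f x - (- (L / x))|.
  move=> x0; rewrite -[X in _ = X * _](gtr0_norm x0) -normrM distrC; congr (`|_|).
  by field; rewrite gt_eqF.
split=> [/eqoP oL|/cvgrPdist_le cL].
  apply/cvgrPdist_le => e e0; near=> x.
  have x0 : 0 < x by near: x; exact: nbhs_right_gt.
  rewrite normE// -ler_pdivlMl//.
  have -> : x^-1 * e = e * `|x^-1| by rewrite gtr0_norm ?invr_gt0// mulrC.
  by near: x; exact: oL.
apply/eqoP => e e0; near=> x.
have x0 : 0 < x by near: x; exact: nbhs_right_gt.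
rewrite [`|x^-1|]gtr0_norm ?invr_gt0// [leRHS]mulrC ler_pdivlMl// -normE//.
by near: x; exact: cL.
Unshelve. all: by end_near. Qed.

(** The hypothesis says that f + L / s is nonincreasing on [x, x0]; comparing its
    values at the two endpoints and multiplying by x gives the bound. *)
Lemma mul_pole_le f L x x0 : 0 < x -> x <= x0 ->
  (forall s, x <= s <= x0 -> derivable f s 1) ->
  (forall s, x <= s <= x0 -> s ^+ 2 * derive1 f s <= L) ->
  - L + (f x0 + L / x0) * x <= x * f x.
Proof.
move=> x_gt0 xx0 df dfL.
have : - (f x + L * x^-1) <= - (f x0 + L * x0^-1).
  apply: (is_derive_ge0_le (f := fun s => - (f s + L * s^-1))
    (df := fun s => - (derive1 f s + L * - s ^- 2))) => // s sx.
    have s0 : 0 < s by case/andP: sx => + _; exact: lt_le_trans.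
    apply: is_derive_opp; apply: is_derive_add.
      by apply: DeriveDef; [exact: df|rewrite derive1E].
    exact/is_derive_scale/is_derive_inv.
  have s0 : 0 < s by case/andP: sx => + _; exact: lt_le_trans.
  rewrite oppr_ge0 -(@pmulr_rle0 _ (s ^+ 2)) ?exprn_gt0// mulrDr.
  have -> : s ^+ 2 * (L * - s ^- 2) = - L by field; rewrite gt_eqF.
  by rewrite subr_le0 dfL.
rewrite lerN2 -(ler_pM2l x_gt0); set A := f x0 + _.
have -> : x * (f x + L * x^-1) = x * f x + L by field; rewrite gt_eqF.
by lra.
Qed.

(** A one-sided L'Hopital rule for the quotient f / (1 / x): the error terms of
    [mul_pole_le], applied to f and to - f with L perturbed by e / 2, vanish
    with x. *)
Lemma cvg_pole f L : (forall x, 0 < x -> derivable f x 1) ->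
  x ^+ 2 * derive1 f x @[x --> 0^'+] --> L -> x * f x @[x --> 0^'+] --> - L.
Proof.
move=> df /cvgrPdist_le cL; apply/cvgrPdist_le => e e0.
have e20 : 0 < e / 2 by rewrite divr_gt0.
have /at_right0P[x0 x00 near0] := cL _ e20.
pose A := f x0 + (L + e / 2) / x0; pose B := - f x0 + (- (L - e / 2)) / x0.
near=> x; have x_gt0 : 0 < x by near: x; exact: nbhs_right_gt.
have xx0 : x <= x0 by near: x; exact: nbhs_right_le.
have small : x <= e / 2 / (`|A| + `|B| + 1).
  by near: x; apply: nbhs_right_le; rewrite divr_gt0// ltr_wpDl// addr_ge0.
have nearE s : x <= s <= x0 -> L - e / 2 <= s ^+ 2 * derive1 f s <= L + e / 2.
  move=> /andP[xs sx0]; have /near0 : 0 < s <= x0 by rewrite sx0 (lt_le_trans x_gt0).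
  by rewrite ler_norml => /andP[? ?]; apply/andP; split; lra.
have F1 : - (L + e / 2) + A * x <= x * f x.
  apply: mul_pole_le => // s sx; first by apply: df; case/andP: sx => + _; exact: lt_le_trans.
  by have /andP[] := nearE _ sx.
have F2 : - - (L - e / 2) + B * x <= x * - f x.
  apply: (@mul_pole_le (fun s => - f s)) => // s sx.
    by apply/derivableN/df; case/andP: sx => + _; exact: lt_le_trans.
  have s0 : 0 < s by case/andP: sx => + _; exact: lt_le_trans.
  rewrite derive1E deriveN; last exact: df.
  by rewrite -derive1E mulrN lerN2; have /andP[] := nearE _ sx.
have small' : (`|A| + `|B| + 1) * x <= e / 2.
  by rewrite -ler_pdivlMl ?ltr_wpDl// ?addr_ge0// mulrC.
have Ax : - (`|A| * x) <= A * x by rewrite -mulNr ler_pM2r// lerNl -normrN ler_norm.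
have Bx : - (`|B| * x) <= B * x by rewrite -mulNr ler_pM2r// lerNl -normrN ler_norm.
have A0 : 0 <= `|A| * x by rewrite mulr_ge0// ltW.
have B0 : 0 <= `|B| * x by rewrite mulr_ge0// ltW.
rewrite ler_norml; apply/andP; split; lra.
Unshelve. all: by end_near. Qed.

Section OnePressure.
Variables (p : R -> R).
Hypothesis pp : pressure p.
Local Notation c := (sound_speed p).
Local Notation rar := (rarefaction_integral p).
Local Notation K := (rarefaction_primitive p).

Lemma condC3aE : condC3a p <-> exists2 p0 : R, 0 < p0 & x * p x @[x --> 0^'+] --> - p0.
Proof. by split=> -[p0 p00 /littleo_invx_cvg h]; exists p0. Qed.

Lemma powR_double x eta : 0 < x -> x `^ (2 * eta) = (x `^ eta) ^+ 2.
Proof.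
by move=> x0; rewrite mulr_natl mulr2n powRD ?(gt_eqF x0)/= ?implybT.
Qed.

Lemma sqr_powR_sound_speed x eta : 0 < x ->
  (x `^ eta * c x) ^+ 2 = x `^ (2 * eta) * derive1 p x.
Proof. by move=> x0; rewrite exprMn sqr_sound_speed// powR_double. Qed.

Lemma cvg_powR_sound_speed eta L : 0 <= L ->
  x `^ eta * c x @[x --> 0^'+] --> L <->
  x `^ (2 * eta) * derive1 p x @[x --> 0^'+] --> L ^+ 2.
Proof.
move=> L0; split=> cL.
  apply: (@cvg_eq_right0 (fun x => (x `^ eta * c x) * (x `^ eta * c x))).
    by move=> x x0; rewrite -sqr_powR_sound_speed.
  exact: cvgM.
apply: (@cvg_eq_right0 (fun x => Num.sqrt (x `^ (2 * eta) * derive1 p x))).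
  move=> x x0; rewrite -sqr_powR_sound_speed// sqrtr_sqr ger0_norm//.
  by rewrite mulr_ge0 ?powR_ge0 ?sqrtr_ge0.
rewrite -[L in _ --> L](ger0_norm L0) -sqrtr_sqr.
by apply: continuous_cvg => //; exact: sqrt_continuous.
Qed.

Lemma cvg_powR0_sound_speed L : x `^ 0 * c x @[x --> 0^'+] --> L <-> c x @[x --> 0^'+] --> L.
Proof. by split; apply: cvg_eq_right0 => x _; rewrite powRr0 mul1r. Qed.

Lemma cvg_dpressure0 : c x @[x --> 0^'+] --> (0 : R) <->
  derive1 p x @[x --> 0^'+] --> (0 : R).
Proof.
rewrite -cvg_powR0_sound_speed cvg_powR_sound_speed// expr0n /= mulr0.
by split; apply: cvg_eq_right0 => x _; rewrite powRr0 mul1r.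
Qed.

(** The squared form of [sound_speed_order], stated for p' because it is linear
    in the pressure. *)
Definition dpressure_order eta := exists2 L : R, 0 < L &
  x `^ (2 * eta) * derive1 p x @[x --> 0^'+] --> L.

Lemma sound_speed_orderE eta : sound_speed_order p eta <-> dpressure_order eta.
Proof.
split=> -[L L0 cL].
  by exists (L ^+ 2); rewrite ?exprn_gt0//; apply/cvg_powR_sound_speed/cL/ltW.
exists (Num.sqrt L); first by rewrite sqrtr_gt0.
by apply/cvg_powR_sound_speed; rewrite ?sqrtr_ge0// sqr_sqrtr// ltW.
Qed.

(** Alternative (b)(ii) is the case eta = 0 of (b)(iii). *)
Lemma condC3b23E : condC3b2 p \/ condC3b3 p <->
  exists2 eta : R, 0 <= eta < 1 & dpressure_order eta.
Proof.
split=> [[[L L0 cL]|[eta /andP[e0 e1] /sound_speed_orderE ?]]|].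
- exists 0; rewrite ?lexx ?ltr01//; apply/sound_speed_orderE.
  by exists L => //; exact/cvg_powR0_sound_speed.
- by exists eta => //; rewrite ltW.
move=> [eta /andP[]]; rewrite le_eqVlt => /predU1P[<- _|e0 e1] /sound_speed_orderE.
  by move=> [L L0 cL]; left; exists L => //; exact/cvg_powR0_sound_speed.
by move=> ?; right; exists eta => //; rewrite e0.
Qed.

Lemma condC3E : condC3 p <-> [\/ condC3a p, condC3b1 p |
  exists2 eta : R, 0 <= eta < 1 & dpressure_order eta].
Proof.
rewrite /condC3; split.
  move=> [?|[?|?|?]]; [exact: Or31|exact: Or32|apply: Or33..].
    by apply/condC3b23E; left.
  by apply/condC3b23E; right.
by move=> [?|?|/condC3b23E[?|?]]; [left|right..]; [|exact: Or31|exact: Or32|exact: Or33].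
Qed.

Lemma powR_dpressure_cvg0 e e' L : e < e' -> x `^ e * derive1 p x @[x --> 0^'+] --> L ->
  x `^ e' * derive1 p x @[x --> 0^'+] --> (0 : R).
Proof.
move=> ee' cL; rewrite -[X in _ --> X](mul0r L).
apply: (@cvg_eq_right0 (fun x => x `^ (e' - e) * (x `^ e * derive1 p x))).
  by move=> x x0; rewrite mulrA -powRD ?subrK// (gt_eqF x0)/= implybT.
by apply: cvgM => //; apply: powR_cvg0; rewrite subr_gt0.
Qed.

Lemma powR2_dpressureE x : 0 < x -> x `^ 2 * derive1 p x = x ^+ 2 * derive1 p x.
Proof. by move=> x0; rewrite powR_mulrn// ltW. Qed.

Lemma sqr_impedance_cvg0 e L : e < 2 -> x `^ e * derive1 p x @[x --> 0^'+] --> L ->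
  x ^+ 2 * derive1 p x @[x --> 0^'+] --> (0 : R).
Proof.
by move=> e2 /(powR_dpressure_cvg0 e2); apply: cvg_eq_right0; exact: powR2_dpressureE.
Qed.

Lemma pressure_cvg_pole L : x ^+ 2 * derive1 p x @[x --> 0^'+] --> L ->
  x * p x @[x --> 0^'+] --> - L.
Proof.
by apply: cvg_pole => x x0; have [] := pressure_is_derive pp x0.
Qed.

Lemma rarefaction_ge (F f : R -> R) (a r : R) : 0 < a -> a <= r ->
  (forall s, a <= s <= r -> is_derive s 1 F (f s)) ->
  (forall s, a <= s <= r -> f s <= c s / s) -> F r - F a <= rar a r.
Proof.
move=> a0 ar dF Ff; rewrite rarefaction_integralE//.
have := @is_derive_ge0_le R (fun s => K s + - F s) (fun s => c s / s - f s) a r ar.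
have: forall s, a <= s <= r -> is_derive s 1 (fun s => K s + - F s) (c s / s - f s).
  move=> s sar; apply: is_derive_add; last exact/is_derive_opp/dF.
  apply: rarefaction_primitive_is_derive => //.
  by case/andP: sar => + _; exact: lt_le_trans.
move=> dKF /(_ dKF) KF.
have : K a - F a <= K r - F r by apply: KF => s /Ff; rewrite subr_ge0.
by lra.
Qed.

(** The rarefaction integral diverges at least like m / s. *)
Lemma vacuum_reachable_of_lower_bound m e : 0 < m -> 0 < e ->
  (forall x, 0 < x <= e -> m <= c x) -> vacuum_reachable p.
Proof.
move=> m0 e0 mc r y r0 _; pose s := Num.min r e.
have s0 : 0 < s by rewrite lt_min r0.
have sr : s <= r by rewrite ge_min lexx.
(* On (a, s) the lower bound m / u integrates to |y| + 1. *)
pose a := s * expR (- ((`|y| + 1) / m)).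
have ym0 : 0 < (`|y| + 1) / m by rewrite divr_gt0// ltr_wpDl.
have a0 : 0 < a by rewrite mulr_gt0// expR_gt0.
have as_ : a < s by rewrite gtr_pMr// expR_lt1 oppr_lt0.
exists a; first by rewrite a0 (lt_le_trans as_).
rewrite (rarefaction_integralD pp a0 (ltW as_) sr).
have rar0 : 0 <= rar s r.
  by rewrite rarefaction_integralE// subr_ge0 rarefaction_primitive_le.
have := @rarefaction_ge (fun s => m * ln s) (fun s => m * s^-1) a s a0 (ltW as_).
have -> : m * ln s - m * ln a = `|y| + 1.
  rewrite /a lnM ?posrE ?expR_gt0// expRK mulrDr opprD addNKr.
  by rewrite mulrN opprK mulrC divfK// gt_eqF.
move=> h; have : `|y| + 1 <= rar a s.
  apply: h => u /andP[au us]; have u0 := lt_le_trans a0 au.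
    exact/is_derive_scale/is_derive1_ln.
  by rewrite ler_pM2r ?invr_gt0// mc// u0 (le_trans us)// ge_min lexx orbT.
by have := ler_norm y; lra.
Qed.

(** Here c(s) / s is nonincreasing, as p'(s) / s^2 has derivative
    - (2 p'(s) - s p''(s)) / s^3; hence the integral from a to r is at least
    (c(r) / r) (r - a), which tends to c(r) as a tends to 0. *)
Lemma vacuum_reachable_of_C3b1 : (forall x, 0 < x ->
  0 <= 2 * derive1 p x - x * derive1n 2 p x) -> vacuum_reachable p.
Proof.
move=> b1 r y r0 yc; have c0 : 0 < c r by exact: sound_speed_gt0.
have cs s : 0 < s -> s <= r -> c r / r <= c s / s.
  move=> s0 sr; rewrite -ler_sqr ?nnegrE ?divr_ge0 ?sqrtr_ge0 ?(ltW r0) ?(ltW s0)//.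
  rewrite !expr_div_n !sqr_sound_speed//.
  have d u : s <= u <= r -> is_derive u 1 (fun v => - (derive1 p v * (v^-1 * v^-1)))
      (u^-1 ^+ 3 * (2 * derive1 p u - u * derive1n 2 p u)).
    move=> /andP[su _]; have u0 := lt_le_trans s0 su.
    have d1 := is_derive_mul (is_derive_inv u0) (is_derive_inv u0).
    apply: (is_derive_eq
      (is_derive_opp (is_derive_mul (dpressure_is_derive pp u0) d1))).
    by rewrite /=; field; rewrite gt_eqF.
  rewrite -[r ^- 2]exprVn -[s ^- 2]exprVn -[leLHS]opprK -[leRHS]opprK lerN2.
  apply: (is_derive_ge0_le sr d) => u /andP[su _].
  have u0 := lt_le_trans s0 su.
  by rewrite mulr_ge0 ?b1// exprn_ge0// invr_ge0 ltW.
(* For this a, (c(r) / r) (r - a) is the midpoint of y' and c(r). *)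
pose y' := Num.max y 0; pose a := r * ((c r - y') / (2 * c r)).
have y'c : y' < c r by rewrite gt_max yc.
have y'0 : 0 <= y' by rewrite le_max lexx orbT.
have a0 : 0 < a by rewrite mulr_gt0// divr_gt0 ?subr_gt0// mulr_gt0.
have ar : a < r by rewrite gtr_pMr// ltr_pdivrMr ?mulr_gt0//; lra.
exists a; first by rewrite a0.
apply: (@lt_le_trans _ _ (c r / r * r - c r / r * a)).
  have -> : c r / r * r - c r / r * a = (c r + y') / 2.
    by rewrite /a; field; rewrite !gt_eqF.
  have : y <= y' by rewrite le_max lexx.
  lra.
apply: (@rarefaction_ge (fun s => c r / r * s) (fun=> c r / r)) => // [|s|s].
- exact: ltW.
- move=> _; apply: (is_derive_eq (is_derive_scale _ (is_derive_id s 1))).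
  by rewrite mulr1.
- by move=> /andP[/(lt_le_trans a0) s0 sr]; exact: cs.
Qed.

(** Since x^eta <= 1 on (0, 1], a positive limit of x^eta c(x) bounds c itself
    away from 0 near vacuum. *)
Lemma vacuum_reachable_of_order eta : 0 <= eta -> sound_speed_order p eta ->
  vacuum_reachable p.
Proof.
move=> eta0 [L L0 /cvgr_gt /(_ (L / 2))].
have L2 : L / 2 < L by rewrite ltr_pdivrMr// ltr_pMr// ltr1n.
move=> /(_ L2) /at_right0P[e e0 ce].
apply: (@vacuum_reachable_of_lower_bound (L / 2) (Num.min e 1)).
- by rewrite divr_gt0.
- by rewrite lt_min e0 ltr01.
- move=> x /andP[x0]; rewrite le_min => /andP[xe x1].
  have /ce/ltW/le_trans : 0 < x <= e by rewrite x0.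
  apply; rewrite ler_piMl ?sqrtr_ge0//.
  have := @ge0_ler_powR R eta eta0 x 1; rewrite powR1; apply => //.
    by rewrite nnegrE ltW.
  by rewrite nnegrE.
Qed.

Hypothesis C1 : forall x, 0 < x -> 0 <= 2 * derive1 p x + x * derive1n 2 p x.

Lemma sqr_impedance_cvg : exists2 L : R, 0 <= L /\
  (forall x, 0 < x -> L <= x ^+ 2 * derive1 p x) &
  x ^+ 2 * derive1 p x @[x --> 0^'+] --> L.
Proof.
set G := fun x => x ^+ 2 * derive1 p x.
pose I : set R := [set` Interval (BRight (0:R)) (BInfty R false)].
have G0 : lbound [set G x | x in I] 0.
  move=> y [x]; rewrite /I /= in_itv /= andbT => x0 <-.
  by rewrite mulr_ge0 ?sqr_ge0// ltW// dpressure_gt0.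
have hG : has_lbound [set G x | x in I] by exists 0.
exists (inf [set G x | x in I]); last first.
  apply: nondecreasing_at_right_cvgr => // x y.
  rewrite !in_itv /= !andbT => x0 y0; exact: sqr_impedance_nondecreasing.
split=> [|x x0]; last by apply: ge_inf => //; exists x => //; rewrite /I /= in_itv /= x0.
by apply: lb_le_inf => //; exists (G 1), 1 => //; rewrite /I /= in_itv /= ltr01.
Qed.

(** Under (C1) the limit of x^2 p'(x) at 0 exists and is nonnegative; by
    L'Hopital's rule it is the coefficient p0 of the pole of the pressure, and
    (C3)(a) holds exactly when it does not vanish. *)
Lemma condC3a_sqr_impedance L : x ^+ 2 * derive1 p x @[x --> 0^'+] --> L ->
  (condC3a p <-> 0 < L).
Proof.
move=> /pressure_cvg_pole cL; rewrite condC3aE; split=> [[L' L'0 cL']|]; last by exists L.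
by rewrite -(oppr_inj (cvg_unique (@Rhausdorff R) cL' cL)).
Qed.

Lemma vacuum_reachable_of_C3a : condC3a p -> vacuum_reachable p.
Proof.
have [L [L0 Lle] cL] := sqr_impedance_cvg.
move=> /(condC3a_sqr_impedance cL) Lgt0.
apply: (@vacuum_reachable_of_lower_bound (Num.sqrt L) 1) => //.
  by rewrite sqrtr_gt0.
move=> x /andP[x0 x1]; apply: ler_wsqrtr; apply: le_trans (Lle _ x0) _.
by rewrite ler_piMl ?exprn_ile1 ?(ltW x0)// ltW// dpressure_gt0.
Qed.

Lemma vacuum_reachable_of_C3 : condC3 p -> vacuum_reachable p.
Proof.
move=> /condC3E[|[_]|[eta /andP[eta0 _] /sound_speed_orderE]].
- exact: vacuum_reachable_of_C3a.
- exact: vacuum_reachable_of_C3b1.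
- exact: vacuum_reachable_of_order.
Qed.

End OnePressure.
End Vacuum.

(** * Linear combinations of pressures *)

Section Cone.
Context {R : realType}.
Implicit Types (p : R -> R) (x a b L eta : R).

Lemma lincomb_ge0 (a b A B C : R) : 0 <= a -> 0 <= b -> 0 <= A -> 0 <= B ->
  C = a * A + b * B -> 0 <= C.
Proof. by move=> a0 b0 A0 B0 ->; rewrite addr_ge0// mulr_ge0. Qed.

Lemma cvg_lincomb (F : set_system R) {FF : Filter F} (f g : R -> R) (a b L1 L2 : R) :
  f x @[x --> F] --> L1 -> g x @[x --> F] --> L2 ->
  a * f x + b * g x @[x --> F] --> a * L1 + b * L2.
Proof.
by move=> c1 c2; exact: cvgD (cvgM (cvg_cst a) c1) (cvgM (cvg_cst b) c2).
Qed.

Lemma continuous_lincomb (f g : R -> R) (a b x : R) :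
  {for x, continuous f} -> {for x, continuous g} ->
  {for x, continuous (fun y => a * f y + b * g y)}.
Proof. exact: cvg_lincomb. Qed.

Section TwoPressures.
Variables (p1 p2 : R -> R) (a b : R).
Hypotheses (a0 : 0 < a) (b0 : 0 < b) (pp1 : pressure p1) (pp2 : pressure p2).
Let q x := a * p1 x + b * p2 x.

Lemma derive1n_lincomb (k : nat) x : (k <= 3)%N -> 0 < x ->
  derive1n k q x = a * derive1n k p1 x + b * derive1n k p2 x.
Proof.
elim: k x => // k IH x k3 x0; rewrite !derive1nS.
transitivity (derive1 (fun x => a * derive1n k p1 x + b * derive1n k p2 x) x).
  by apply: (@derive1n_eq_pos _ _ _ 1) => // y y0; rewrite IH// ltnW.
have d1 := derive1n_is_derive pp1 k3 x0; have d2 := derive1n_is_derive pp2 k3 x0.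
have [_ <-] := is_derive_add (is_derive_scale a d1) (is_derive_scale b d2).
by rewrite derive1E.
Qed.

Lemma dpressure_lincomb x : 0 < x ->
  derive1 q x = a * derive1 p1 x + b * derive1 p2 x.
Proof. exact: (@derive1n_lincomb 1). Qed.

Lemma pressure_lincomb : pressure q.
Proof.
split=> [x x0|x x0].
  split=> [k k3|].
    apply: (@derivable_eq_pos _ (fun x => a * derive1n k p1 x + b * derive1n k p2 x)) => //.
      by move=> y y0; rewrite derive1n_lincomb// ltnW.
    have d1 := derive1n_is_derive pp1 k3 x0; have d2 := derive1n_is_derive pp2 k3 x0.
    by have [] := is_derive_add (is_derive_scale a d1) (is_derive_scale b d2).
  apply: (@continuous_eq_pos _ (fun x => a * derive1n 3 p1 x + b * derive1n 3 p2 x)) => //.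
    by move=> y y0; rewrite derive1n_lincomb.
  have [/(_ x x0)[_ c1] _] := pp1; have [/(_ x x0)[_ c2] _] := pp2.
  exact (@continuous_lincomb _ _ a b x c1 c2).
by rewrite dpressure_lincomb// addr_gt0// mulr_gt0// dpressure_gt0.
Qed.

Lemma condC1_lincomb : condC1 p1 -> condC1 p2 -> condC1 q.
Proof.
move=> C1 C2 x x0; have [A1 B1] := C1 x x0; have [A2 B2] := C2 x x0.
rewrite (dpressure_lincomb x0) (@derive1n_lincomb 2 x isT x0).
rewrite (@derive1n_lincomb 3 x isT x0).
split.
  apply: (lincomb_ge0 (ltW a0) (ltW b0) A1 A2).
  move: (derive1 p1 x) (derive1 p2 x) (derive1n 2 p1 x) (derive1n 2 p2 x).
  by clear; move=> *; ring.
apply: (lincomb_ge0 (ltW a0) (ltW b0) B1 B2).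
move: (derive1 p1 x) (derive1 p2 x) (derive1n 2 p1 x) (derive1n 2 p2 x).
move: (derive1n 3 p1 x) (derive1n 3 p2 x).
by clear; move=> *; ring.
Qed.

(** An increasing second pressure is bounded below by its value at 1 on [1, oo),
    so it cannot cancel the growth of the first one. *)
Lemma cvgy_lincomb : p1 x @[x --> +oo%R] --> +oo%R -> q x @[x --> +oo%R] --> +oo%R.
Proof.
move=> /cvgryPge p1y; apply/cvgryPge => A; near=> x.
have x1 : 1 <= x by near: x; exact: nbhs_pinfty_ge.
have p2x : b * p2 1 <= b * p2 x by rewrite ler_pM2l// pressure_le.
rewrite -lerBlDr; apply: le_trans (_ : A - b * p2 1 <= _); first by lra.
rewrite -ler_pdivrMl//.
by near: x; exact: p1y.
Unshelve. all: by end_near. Qed.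

Lemma powR_dpressure_lincomb e L1 L2 :
  x `^ e * derive1 p1 x @[x --> 0^'+] --> L1 ->
  x `^ e * derive1 p2 x @[x --> 0^'+] --> L2 ->
  x `^ e * derive1 q x @[x --> 0^'+] --> a * L1 + b * L2.
Proof.
move=> c1 c2.
apply: (@cvg_eq_right0 _ (fun x => a * (x `^ e * derive1 p1 x) + b * (x `^ e * derive1 p2 x))).
  by move=> x x0; rewrite dpressure_lincomb//; ring.
exact: cvg_lincomb.
Qed.

Lemma pole_lincomb L1 L2 :
  x * p1 x @[x --> 0^'+] --> - L1 -> x * p2 x @[x --> 0^'+] --> - L2 ->
  x * q x @[x --> 0^'+] --> - (a * L1 + b * L2).
Proof.
move=> c1 c2; rewrite opprD -!mulrN.
apply: (@cvg_eq_right0 _ (fun x => a * (x * p1 x) + b * (x * p2 x))).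
  by move=> x x0; rewrite /q; ring.
exact: cvg_lincomb.
Qed.

End TwoPressures.

Lemma powR0_dpressureE p (L : R) : x `^ (2 * 0) * derive1 p x @[x --> 0^'+] --> L <->
  derive1 p x @[x --> 0^'+] --> L.
Proof.
by rewrite mulr0; split; apply: cvg_eq_right0 => x _; rewrite powRr0 mul1r.
Qed.

(** Every alternative of (C3) forces at most a simple pole at vacuum, and outside
    (a) the coefficient is 0: x^2 p'(x) tends to 0 because the exponent 2 eta is
    less than 2. *)
Lemma condC3_pole p : pressure p -> condC3 p ->
  exists2 L : R, 0 <= L & x * p x @[x --> 0^'+] --> - L.
Proof.
move=> pp /(condC3E pp)[/condC3aE[L L0 cL]|[+ _]|[eta /andP[_ e1] [L L0 cL]]].
- by exists L => //; exact: ltW.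
- move=> /cvg_dpressure0 -/(_ pp)/powR0_dpressureE/sqr_impedance_cvg0 c0; exists 0 => //.
  by apply: (pressure_cvg_pole pp); apply: c0; rewrite mulr0.
- exists 0 => //; apply: (pressure_cvg_pole pp); apply: sqr_impedance_cvg0 cL.
  by rewrite gtr_pMr.
Qed.

Lemma convex_cone_C1 : convex_cone [set p : R -> R | pressure p /\ condC1 p].
Proof.
move=> a b p1 p2 a0 b0 [pp1 c1] [pp2 c2].
by split; [exact: pressure_lincomb|exact: condC1_lincomb].
Qed.

(** Two pressures satisfying (b) combine by linearity; if one of them is
    unbounded, so is the combination. *)
Lemma convex_cone_C2 : convex_cone [set p : R -> R | pressure p /\ condC2 p].
Proof.
move=> a b p1 p2 a0 b0 [pp1 c1] [pp2 c2]; split; first exact: pressure_lincomb.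
have [c1y|c1b] := c1; first by left; exact: cvgy_lincomb.
have [c2y|c2b] := c2.
  left; under eq_fun do rewrite addrC; exact: cvgy_lincomb.
right=> x x0; rewrite dpressure_lincomb//.
have -> : - ((a * p1 x + b * p2 x) / x) = a * - (p1 x / x) + b * - (p2 x / x).
  by ring.
by rewrite lerD// ler_pM2l ?c1b ?c2b.
Qed.

Lemma powR_dpressure_cvg_le p (e e' L : R) : e <= e' -> 0 <= L ->
  x `^ e * derive1 p x @[x --> 0^'+] --> L ->
  exists2 L' : R, 0 <= L' & x `^ e' * derive1 p x @[x --> 0^'+] --> L'.
Proof.
rewrite le_eqVlt => /predU1P[<-|ee'] L0 cL; first by exists L.
by exists 0 => //; exact: powR_dpressure_cvg0 cL.
Qed.

Lemma condC3a_lincomb p1 p2 (a b : R) : 0 < a -> 0 < b -> pressure p2 ->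
  condC3a p1 -> condC3 p2 -> condC3a (fun x => a * p1 x + b * p2 x).
Proof.
move=> a0 b0 pp2 /condC3aE[L1 L10 c1] /(condC3_pole pp2)[L2 L20 c2].
apply/condC3aE; exists (a * L1 + b * L2); last exact: pole_lincomb.
by rewrite ltr_pwDl ?mulr_gt0// mulr_ge0// ltW.
Qed.

(** The larger exponent dominates: at that exponent the other summand has a
    nonnegative, possibly zero, limit. *)
Lemma dpressure_order_lincomb p1 p2 (a b eta L : R) : 0 < a -> 0 < b ->
  pressure p1 -> pressure p2 -> dpressure_order p1 eta -> 0 <= L ->
  x `^ (2 * eta) * derive1 p2 x @[x --> 0^'+] --> L ->
  dpressure_order (fun x => a * p1 x + b * p2 x) eta.
Proof.
move=> a0 b0 pp1 pp2 [L1 L10 c1] L0 c2; exists (a * L1 + b * L).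
  by rewrite ltr_pwDl ?mulr_gt0// mulr_ge0// ltW.
exact: powR_dpressure_lincomb.
Qed.

Lemma condC3b1_order0 p : pressure p -> condC3b1 p ->
  x `^ (2 * 0) * derive1 p x @[x --> 0^'+] --> (0 : R).
Proof. by move=> pp [/cvg_dpressure0 -/(_ pp) c0 _]; exact/powR0_dpressureE. Qed.

Lemma condC3b1_lincomb p1 p2 (a b : R) : 0 < a -> 0 < b -> pressure p1 -> pressure p2 ->
  condC3b1 p1 -> condC3b1 p2 -> condC3b1 (fun x => a * p1 x + b * p2 x).
Proof.
move=> a0 b0 pp1 pp2 h1 h2; have pq := pressure_lincomb a0 b0 pp1 pp2.
split.
  apply/(cvg_dpressure0 pq)/powR0_dpressureE.
  have := @powR_dpressure_lincomb p1 p2 a b pp1 pp2 _ _ _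
    (condC3b1_order0 pp1 h1) (condC3b1_order0 pp2 h2).
  by rewrite !mulr0 addr0.
move=> x x0; rewrite dpressure_lincomb//.
rewrite (@derive1n_lincomb p1 p2 a b pp1 pp2 2)//.
have [_ /(_ x x0) h1x] := h1; have [_ /(_ x x0) h2x] := h2.
apply: (lincomb_ge0 (ltW a0) (ltW b0) h1x h2x).
move: (derive1 p1 x) (derive1 p2 x) (derive1n 2 p1 x) (derive1n 2 p2 x).
by clear; move=> *; ring.
Qed.

Lemma condC3_lincomb p1 p2 (a b : R) : 0 < a -> 0 < b -> pressure p1 -> pressure p2 ->
  condC3 p1 -> condC3 p2 -> condC3 (fun x => a * p1 x + b * p2 x).
Proof.
move=> a0 b0 pp1 pp2 C31 C32.
have pq := pressure_lincomb a0 b0 pp1 pp2; apply/(condC3E pq).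
have qC : (fun x => a * p1 x + b * p2 x) = (fun x => b * p2 x + a * p1 x).
  by apply/funext => x; rewrite addrC.
have le2 (e e' : R) : e <= e' -> 2 * e <= 2 * e' by rewrite ler_pM2l.
case/(condC3E pp1) : (C31) => [h1|h1|[e1 /andP[e10 e11] h1]].
- by apply: Or31; exact: condC3a_lincomb.
- case/(condC3E pp2) : (C32) => [h2|h2|[e2 /andP[e20 e21] h2]].
  + by apply: Or31; rewrite qC; exact: condC3a_lincomb.
  + by apply: Or32; exact: condC3b1_lincomb.
  + apply: Or33; exists e2; first by rewrite e20.
    have [L L0 cL] := powR_dpressure_cvg_le (le2 _ _ e20) (lexx 0) (condC3b1_order0 pp1 h1).
    by rewrite qC; exact: dpressure_order_lincomb cL.
- case/(condC3E pp2) : (C32) => [h2|h2|[e2 /andP[e20 e21] h2]].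
  + by apply: Or31; rewrite qC; exact: condC3a_lincomb.
  + apply: Or33; exists e1; first by rewrite e10.
    have [L L0 cL] := powR_dpressure_cvg_le (le2 _ _ e10) (lexx 0) (condC3b1_order0 pp2 h2).
    exact: dpressure_order_lincomb cL.
  + apply: Or33; have [e12|/ltW e12] := leP e1 e2.
      exists e2; first by rewrite e20.
      have [L /ltW L0 cL] := h1; have [L' L'0 cL'] := powR_dpressure_cvg_le (le2 _ _ e12) L0 cL.
      by rewrite qC; exact: dpressure_order_lincomb cL'.
    exists e1; first by rewrite e10.
    have [L /ltW L0 cL] := h2; have [L' L'0 cL'] := powR_dpressure_cvg_le (le2 _ _ e12) L0 cL.
    exact: dpressure_order_lincomb cL'.
Qed.

Lemma convex_cone_C3 : convex_cone [set p : R -> R | pressure p /\ condC3 p].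
Proof.
move=> a b p1 p2 a0 b0 [pp1 c1] [pp2 c2].
by split; [exact: pressure_lincomb|exact: condC3_lincomb].
Qed.

Lemma convex_cone_admissible : convex_cone [set p : R -> R | admissible p].
Proof.
move=> a b p1 p2 a0 b0 [pp1 c11 c12 c13] [pp2 c21 c22 c23].
have [pq cq1] := convex_cone_C1 a0 b0 (conj pp1 c11) (conj pp2 c21).
have [_ cq2] := convex_cone_C2 a0 b0 (conj pp1 c12) (conj pp2 c22).
by split; [exact: pq|exact: cq1|exact: cq2|exact: condC3_lincomb].
Qed.

End Cone.

(** * Integrals over a parameter *)

Section Integral.
Context {R : realType} (d : measure_display) (T : measurableType d).
Variable mu : {measure set T -> \bar R}.
Implicit Types (f g : T -> R).

Lemma integrable_measurable f : mu.-integrable setT (EFin \o f) -> measurable_fun setT f.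
Proof. by move=> /(measurable_int mu)/measurable_EFinP. Qed.

Lemma Rintegral_EFin f : mu.-integrable setT (EFin \o f) ->
  (\int[mu]_t f t)%R%:E = (\int[mu]_t (f t)%:E)%E.
Proof. by move=> /(integrable_fin_num measurableT)/fineK. Qed.

Lemma Rintegral_eq0 f : mu.-integrable setT (EFin \o f) -> (forall t, 0 <= f t) ->
  (\int[mu]_t f t)%R = 0 -> mu.-negligible [set t | 0 < f t].
Proof.
move=> intf f0 If0.
have mf : measurable_fun setT (EFin \o f) := measurable_int mu intf.
have /(ae_eq_integral_abs mu measurableT mf) : (\int[mu]_t `|(EFin \o f) t|)%E = 0%E.
  under eq_integral do rewrite /= ger0_norm//.
  by rewrite -Rintegral_EFin// If0.
apply: negligibleS => t /= ft; apply/existsNP.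
by exists I; move=> [ft0]; rewrite ft0 ltxx in ft.
Qed.

(** Replacing f by its positive part changes it on a null set only. *)
Lemma Rintegral_ae_ge0 f : mu.-integrable setT (EFin \o f) ->
  mu.-negligible [set t | f t < 0] -> 0 <= (\int[mu]_t f t)%R.
Proof.
move=> intf f0.
rewrite -lee_fin Rintegral_EFin//.
have -> : (\int[mu]_t (f t)%:E)%E = (\int[mu]_t (Num.max (f t) 0)%:E)%E.
  apply: ae_eq_integral => //.
  - exact: measurable_int intf.
  - apply/measurable_EFinP; apply: measurable_maxr => //.
    exact: integrable_measurable.
  - apply: negligibleS f0 => t /= /not_implyP[_] h; rewrite ltNge; apply/negP => f0.
    by apply: h; rewrite max_l.
by apply: integral_ge0 => t _; rewrite lee_fin le_max lexx orbT.
Qed.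

Lemma exists_not_negligible (A : set T) : mu setT != 0%E -> mu.-negligible A ->
  exists t, ~ A t.
Proof.
move=> mu0 [B [mB B0 AB]]; apply: contrapT => /forallNP nA.
have BT : B = setT by apply/seteqP; split=> // t _; exact: (AB _ (contrapT (nA t))).
by move: mu0; rewrite -BT; move/eqP; apply; exact: B0.
Qed.

(** Dominated convergence for a continuous parameter tending to 0 from the
    right, reduced to sequences. *)
Lemma cvg_Rintegral_right0 (f : R -> T -> R) (l g : T -> R) :
  (forall x, 0 < x <= 1 -> mu.-integrable setT (EFin \o f x)) ->
  mu.-integrable setT (EFin \o g) ->
  (forall t x, 0 < x <= 1 -> `|f x t| <= g t) ->
  (forall t, f x t @[x --> 0^'+] --> l t) ->
  mu.-integrable setT (EFin \o l) /\
  (\int[mu]_t f x t)%R @[x --> 0^'+] --> (\int[mu]_t l t)%R.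
Proof.
move=> intf intg fg fl.
have ml : measurable_fun setT l.
  apply: (@measurable_fun_cvg _ _ _ _ (fun n t => f (n.+1%:R^-1) t)).
    move=> n; apply/integrable_measurable/intf.
    by rewrite invr_gt0 ltr0n invf_le1 ?ler1n ?ltr0n.
  move=> t _; have /cvg_at_rightP/(_ (fun n => n.+1%:R^-1)) := fl t; apply.
  by split; [move=> n; rewrite invr_gt0 ltr0n|exact: cvg_harmonic].
have il : mu.-integrable setT (EFin \o l).
  apply: (le_integrable measurableT _ _ intg); first exact/measurable_EFinP.
  move=> t _ /=; rewrite lee_fin; apply: le_trans (ler_norm _).
  have nl : `|f x t| @[x --> 0^'+] --> `|l t| by apply: cvg_norm; exact: fl.
  apply: (cvgr_to_le nl); near=> x; apply: fg.
  apply/andP; split; near: x; first exact: nbhs_right_gt.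
  exact: nbhs_right_le.
split=> //; apply/cvg_at_rightP => u [u0 cu].
(* The hypotheses only concern (0, 1], where u n eventually lies. *)
pose v n := Num.min (u n) 1.
have v01 n : 0 < v n <= 1 by rewrite lt_min u0 ltr01 ge_min lexx orbT.
have uv : \forall n \near \oo, v n = u n.
  near=> n; rewrite /v min_l//; near: n.
  by apply: (cvgr_le 0) => //.
have cv : v n @[n --> \oo] --> (0 : R).
  by apply: cvg_trans cu; apply: near_eq_cvg; apply: filterS uv => n /esym.
have [|||||_ _ cI] := @dominated_convergence _ _ _ mu setT measurableT
  (fun n t => (f (v n) t)%:E) (EFin \o l) (EFin \o g).
- by move=> n; apply: measurable_int (intf _ (v01 n)).
- exact/measurable_EFinP.
- apply/aeW => t _; apply: cvg_EFin; first exact: nearW.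
  have /cvg_at_rightP/(_ v) := fl t; apply; split=> // n.
  by have /andP[] := v01 n.
- exact: intg.
- by apply/aeW => t n _; rewrite lee_fin fg.
have : (fun n => (\int[mu]_t f (v n) t)%R) @ \oo --> (\int[mu]_t l t)%R.
  apply: fine_cvg; rewrite Rintegral_EFin//.
apply: cvg_trans; apply: near_eq_cvg; apply: filterS uv => n ->.
by [].
Unshelve. all: by end_near. Qed.

(** By monotone convergence the pointwise supremum of the h n is integrable,
    hence finite almost everywhere. *)
Lemma monotone_bounded_ae (h : nat -> T -> R) (M : R) :
  (forall n, mu.-integrable setT (EFin \o h n)) -> (forall n t, 0 <= h n t) ->
  (forall t, {homo h^~ t : m n / (m <= n)%N >-> m <= n}) ->
  (forall n, (\int[mu]_t h n t)%R <= M) ->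
  mu.-negligible [set t | forall B, exists n, B < h n t].
Proof.
move=> ih h0 hnd hM; pose f t := limn (fun n => (h n t)%:E).
have hndE t : {homo (fun n => (h n t)%:E) : m n / (m <= n)%N >-> (m <= n)%E}.
  by move=> m n mn; rewrite lee_fin hnd.
have hc t : (h n t)%:E @[n --> \oo] --> f t := ereal_nondecreasing_is_cvgn (hndE t).
have mh n : measurable_fun setT (fun t => (h n t)%:E) := measurable_int mu (ih n).
have f0 t : (0 <= f t)%E.
  by apply: lime_ge; [exact: hc|apply: nearW => n; rewrite lee_fin].
have intf : mu.-integrable setT f.
  apply/integrableP; split.
    by apply: (emeasurable_fun_cvg (fun n t => (h n t)%:E)) => // t _; exact: hc.
  under eq_integral do rewrite gee0_abs//.
  apply: (@le_lt_trans _ _ M%:E); last exact: ltry.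
  rewrite (monotone_convergence mu measurableT mh); last 2 first.
  - by move=> n t _; rewrite lee_fin.
  - by move=> t _; exact: hndE.
  apply: lime_le; last by apply: nearW => n; rewrite -Rintegral_EFin// lee_fin.
  apply: ereal_nondecreasing_is_cvgn => m n mn; rewrite -!Rintegral_EFin// lee_fin.
  by apply: le_Rintegral => // t _; exact: hnd.
apply: negligibleS (integrable_ae measurableT intf) => t /= hB fin.
have [n] := hB (fine (f t)); apply/negP; rewrite -leNgt -lee_fin fineK; last exact: fin.
by apply: lime_ge; [exact: hc|near=> m; apply: hndE; near: m; exact: nbhs_infty_ge].
Unshelve. all: by end_near. Qed.

End Integral.

Lemma is_derive_cvg_seq {R : realType} (f : R -> R) (l x : R) : is_derive x 1 f l ->
  n.+1%:R * (f (n.+1%:R^-1 + x) - f x) @[n --> \oo] --> l.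
Proof.
move=> [df <-]; have /cvgr_dnbhsP/(_ (fun n => n.+1%:R^-1)) := df.
have h0 : (forall n : nat, n.+1%:R^-1 != 0 :> R) /\
    (n.+1%:R^-1 : R) @[n --> \oo] --> (0 : R).
  by split; [move=> n; rewrite invr_neq0|exact: cvg_harmonic].
move=> /(_ h0); apply: cvg_trans; apply: near_eq_cvg; apply: nearW => n.
by rewrite /= invrK /GRing.scale /= mulr1.
Qed.

(** * Differentiation of an integrated pressure *)

Section Family.
Context {R : realType} (d : measure_display) (T : measurableType d).
Variables (mu : {measure set T -> \bar R}) (p : T -> R -> R).
Hypotheses (mu0 : mu setT != 0%E) (fam : integrable_family mu p).
Hypothesis pp : forall t, pressure (p t).
Local Notation P := (integral_pressure mu p).
Implicit Types (x : R) (t : T).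

Lemma derive1n_dominated (k : nat) (a b : R) : (0 < k <= 3)%N -> 0 < a -> a < b ->
  exists2 g : T -> R, (forall t, 0 <= g t) /\ mu.-integrable setT (EFin \o g) &
    forall t x, a <= x <= b -> `|derive1n k (p t) x| <= g t.
Proof.
move=> k3 a0 ab; have [_ /(_ k a b k3 a0 ab) [g ig gk]] := fam.
exists g => //; split=> // t; apply: (le_trans _ (gk t a _)) => //.
by rewrite lexx ltW.
Qed.

(** Measurability in the parameter is inherited from the pressures through
    difference quotients; integrability then follows from the domination. *)
Lemma derivative_integrable (k : nat) x : (k <= 3)%N -> 0 < x ->
  mu.-integrable setT (fun t => (derive1n k (p t) x)%:E).
Proof.
elim: k x => [|k IH] x k3 x0; first by have [+ _] := fam; exact.
have x2 : x < x + 1 by rewrite ltrDl.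
have [g [g0 ig] gk] := @derive1n_dominated k.+1 x (x + 1) k3 x0 x2.
apply: (le_integrable measurableT _ _ ig); last first.
  move=> t _; rewrite /= lee_fin; apply: le_trans (ler_norm _).
  by apply: gk; rewrite lexx ltW.
apply/measurable_EFinP.
apply: (@measurable_fun_cvg _ _ _ _
    (fun n t => n.+1%:R * (derive1n k (p t) (n.+1%:R^-1 + x) - derive1n k (p t) x))).
  move=> n; apply: measurable_funM => //; apply: measurable_funB.
    apply/integrable_measurable/IH; rewrite ?(ltnW k3)//.
    by rewrite addr_gt0// invr_gt0 ltr0n.
  by apply/integrable_measurable/IH; rewrite ?(ltnW k3).
by move=> t _; exact/is_derive_cvg_seq/(derive1n_is_derive (pp t) k3 x0).
Qed.

Lemma integral_is_derive (k : nat) x : (k < 3)%N -> 0 < x ->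
  is_derive x 1 (fun y => \int[mu]_t derive1n k (p t) y)%R
    (\int[mu]_t derive1n k.+1 (p t) x)%R.
Proof.
move=> k3 x0; pose u := x / 2; pose v := x + 1.
have u0 : 0 < u by rewrite divr_gt0.
have ux : u < x by rewrite gtr_pMr// invf_lt1 ?ltr1n.
have xv : x < v by rewrite ltrDl.
have [g [g0 ig] gk] := @derive1n_dominated k.+1 u v k3 u0 (lt_trans ux xv).
have Ix : `]u, v[%classic x by rewrite /= in_itv /= ux.
have I0 y : `]u, v[%classic y -> 0 < y.
  by rewrite /= in_itv /= => /andP[uy _]; exact: lt_trans uy.
have int_ y : `]u, v[%classic y -> mu.-integrable setT (EFin \o (derive1n k)^~ y \o p).
  by move=> /I0 y0; apply: derivative_integrable => //; exact: ltnW.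
have der y t : `]u, v[%classic y -> [set: T] t -> derivable (derive1n k (p t)) y 1.
  by move=> /I0 y0 _; have [] := derive1n_is_derive (pp t) k3 y0.
have dom y t : `]u, v[%classic y -> [set: T] t ->
    `|partial1of2 (fun y t => derive1n k (p t) y) y t| <= g t.
  by rewrite /= in_itv /= => /andP[uy yv] _; apply: gk; rewrite !ltW.
apply: DeriveDef.
  exact: (derivable_under_integral measurableT Ix int_ der g0 ig dom).
rewrite -derive1E.
exact: (differentiation_under_integral measurableT Ix int_ der g0 ig dom).
Qed.

Lemma derive1n_integral (k : nat) x : (k <= 3)%N -> 0 < x ->
  derive1n k P x = (\int[mu]_t derive1n k (p t) x)%R.
Proof.
elim: k x => // k IH x k3 x0; rewrite derive1nS.
transitivity (derive1 (fun y => \int[mu]_t derive1n k (p t) y)%R x).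
  by apply: (@derive1n_eq_pos _ _ _ 1) => // y y0; rewrite IH// ltnW.
by have [_ <-] := integral_is_derive k3 x0; rewrite derive1E.
Qed.

Lemma continuous_derive3_integral x : 0 < x -> {for x, continuous (derive1n 3 P)}.
Proof.
move=> x0; pose u := x / 2; pose v := x + 1.
have u0 : 0 < u by rewrite divr_gt0.
have ux : u < x by rewrite gtr_pMr// invf_lt1 ?ltr1n.
have xv : x < v by rewrite ltrDl.
have [g [g0 ig] gk] := @derive1n_dominated 3 u v isT u0 (lt_trans ux xv).
have I0 y : `]u, v[%classic y -> 0 < y.
  by rewrite /= in_itv /= => /andP[uy _]; exact: lt_trans uy.
apply: (@continuous_eq_pos _ (fun y => \int[mu]_t derive1n 3 (p t) y)%R) => //.
  by move=> y y0; rewrite derive1n_integral.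
apply: (@continuity_under_integral R d T mu (fun y t => derive1n 3 (p t) y) setT
  measurableT u v _ _ g ig).
- by move=> y /I0 y0; exact: derivative_integrable.
- apply/aeW => t _ y /set_mem /I0 y0.
  by have [/(_ y y0)[_ +] _] := pp t; exact.
- move=> y; rewrite /= in_itv /= => /andP[uy yv]; apply/aeW => t _.
  by apply: gk; rewrite !ltW.
- by rewrite inE /= in_itv /= ux.
Qed.

Lemma integral_gt0 (f : T -> R) : mu.-integrable setT (EFin \o f) ->
  (forall t, 0 < f t) -> 0 < (\int[mu]_t f t)%R.
Proof.
move=> intf f0; rewrite lt_neqAle Rintegral_ge0 ?andbT; last by move=> t _; exact: ltW.
apply/eqP => /esym If0.
have [t []] := exists_not_negligible mu0 (Rintegral_eq0 intf (fun t => ltW (f0 t)) If0).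
exact: f0.
Qed.

Lemma dpressure_integral x : 0 < x -> derive1 P x = (\int[mu]_t derive1 (p t) x)%R.
Proof. exact: (@derive1n_integral 1). Qed.

Lemma dpressure_integrable x : 0 < x ->
  mu.-integrable setT (EFin \o (fun t => derive1 (p t) x)).
Proof. exact: (@derivative_integrable 1). Qed.

Lemma pressure_integral : pressure P.
Proof.
split=> [x x0|x x0]; last first.
  rewrite dpressure_integral//; apply: integral_gt0; first exact: dpressure_integrable.
  by move=> t; exact: dpressure_gt0.
split; last exact: continuous_derive3_integral.
move=> k k3; have [+ _] := integral_is_derive k3 x0.
by apply: derivable_eq_pos => // y y0; rewrite derive1n_integral// ltnW.
Qed.

End Family.

(** * The three conditions for an integrated pressure *)

(** A bound at the exponent 2 eta leaves no room for a positive limit at a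
    larger exponent e. *)
Lemma bounded_order_le0 {R : realType} (p : R -> R) (eta e g L : R) :
  (forall x, 0 < x <= 1 -> x `^ (2 * eta) * derive1 p x <= g) -> 2 * eta < e ->
  x `^ e * derive1 p x @[x --> 0^'+] --> L -> L <= 0.
Proof.
move=> pg etae cL; rewrite -(mul0r g).
have c0 : x `^ (e - 2 * eta) * g @[x --> (0 : R)^'+] --> 0 * g.
  apply: cvgM; last exact: cvg_cst.
  by apply: powR_cvg0; rewrite subr_gt0.
apply: (ler_cvg_to cL c0); near=> x.
have x0 : 0 < x by near: x; exact: nbhs_right_gt.
have -> : x `^ e = x `^ (e - 2 * eta) * x `^ (2 * eta).
  by rewrite -powRD ?subrK// (gt_eqF x0)/= implybT.
rewrite -mulrA ler_wpM2l ?powR_ge0// pg// x0 /=.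
by near: x; exact: nbhs_right_le.
Unshelve. all: by end_near. Qed.

(** The bound rules out (C3)(a) and all rates beyond eta, so the limit at the
    exponent 2 eta exists.  The last clause isolates the only alternative that is
    left when eta = 0 and the limit vanishes. *)
Lemma bounded_order_cvg {R : realType} (p : R -> R) (eta g : R) :
  pressure p -> condC1 p -> condC3 p -> 0 <= eta < 1 ->
  (forall x, 0 < x <= 1 -> x `^ (2 * eta) * derive1 p x <= g) ->
  exists l : R, [/\ 0 <= l, x `^ (2 * eta) * derive1 p x @[x --> 0^'+] --> l &
    eta = 0 -> l = 0 -> condC3b1 p].
Proof.
move=> pp C1 C3 /andP[eta0 eta1] pg.
have [C3a|C3b1|[e /andP[e0 e1] [L L0 cL]]] := (condC3E pp).1 C3.
- have [L _ cL] := sqr_impedance_cvg pp (fun x x0 => (C1 x x0).1).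
  have := (condC3a_sqr_impedance pp cL).1 C3a; rewrite ltNge => /negP[].
  apply: (bounded_order_le0 pg (e := 2)); first by rewrite gtr_pMr.
  by apply: cvg_eq_right0 cL => x x0; rewrite powR2_dpressureE.
- have eta2 : 2 * 0 <= 2 * eta by rewrite ler_pM2l.
  have [l l0 cl] := powR_dpressure_cvg_le eta2 (lexx 0) (condC3b1_order0 pp C3b1).
  by exists l.
- have [e_eta|eta_e] := leP e eta; last first.
    have : L <= 0 by apply: (bounded_order_le0 pg _ cL); rewrite ltr_pM2l.
    by rewrite leNgt L0.
  have e2 : 2 * e <= 2 * eta by rewrite ler_pM2l.
  have [l l0 cl] := powR_dpressure_cvg_le e2 (ltW L0) cL.
  exists l; split=> // eta_0 l_0.
  have e_0 : e = eta by apply/eqP; rewrite eq_le e_eta eta_0.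
  rewrite e_0 in cL; have Ll := cvg_unique (@Rhausdorff R) cL cl.
  by rewrite Ll l_0 ltxx in L0.
Qed.

Section FamilyConditions.
Context {R : realType} (d : measure_display) (T : measurableType d).
Variables (mu : {measure set T -> \bar R}) (p : T -> R -> R).
Hypotheses (mu0 : mu setT != 0%E) (fam : integrable_family mu p).
Hypothesis pp : forall t, pressure (p t).
Local Notation P := (integral_pressure mu p).
Implicit Types (x : R) (t : T).

Let int1 x (x0 : 0 < x) := @dpressure_integrable R d T mu p fam pp x x0.
Let int2 x (x0 : 0 < x) : mu.-integrable setT (EFin \o (fun t => derive1n 2 (p t) x))
  := @derivative_integrable R d T mu p fam pp 2 x isT x0.
Let int3 x (x0 : 0 < x) : mu.-integrable setT (EFin \o (fun t => derive1n 3 (p t) x))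
  := @derivative_integrable R d T mu p fam pp 3 x isT x0.
Let intZ (f : T -> R) (k : R) : mu.-integrable setT (EFin \o f) ->
  mu.-integrable setT (EFin \o (fun t => k * f t)).
Proof. by move=> intf; exact: (integrableZl measurableT k intf). Qed.
Let intD (f g : T -> R) : mu.-integrable setT (EFin \o f) ->
  mu.-integrable setT (EFin \o g) ->
  mu.-integrable setT (EFin \o (fun t => f t + g t)).
Proof. by move=> intf intg; exact: (integrableD measurableT intf intg). Qed.

Lemma second_order_integral (a b x : R) : 0 < x ->
  a * derive1 P x + b * derive1n 2 P x =
  (\int[mu]_t (a * derive1 (p t) x + b * derive1n 2 (p t) x))%R.
Proof.
move=> x0; rewrite (dpressure_integral fam pp x0).
rewrite (@derive1n_integral _ _ _ _ _ fam pp 2)//.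
rewrite RintegralD; [|exact: measurableT|apply/intZ/int1|apply/intZ/int2] => //.
rewrite (RintegralZl _ _ (int1 x0)); last exact: measurableT.
by rewrite (RintegralZl _ _ (int2 x0)).
Qed.

Lemma second_order_integrable (a b x : R) : 0 < x -> mu.-integrable setT
  (EFin \o (fun t => a * derive1 (p t) x + b * derive1n 2 (p t) x)).
Proof. by move=> x0; apply: intD; apply: intZ; [exact: int1|exact: int2]. Qed.

Lemma third_order_integral (a b e x : R) : 0 < x ->
  a * derive1 P x + b * derive1n 2 P x + e * derive1n 3 P x =
  (\int[mu]_t (a * derive1 (p t) x + b * derive1n 2 (p t) x + e * derive1n 3 (p t) x))%R.
Proof.
move=> x0; rewrite (second_order_integral _ _ x0).
rewrite (@derive1n_integral _ _ _ _ _ fam pp 3)//.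
rewrite [RHS]RintegralD; [|exact: measurableT|exact: second_order_integrable|].
  by rewrite (RintegralZl _ _ (int3 x0)).
exact/intZ/int3.
Qed.

Lemma condC1_integral : (forall t, condC1 (p t)) -> condC1 P.
Proof.
move=> C1 x x0; split.
  rewrite second_order_integral//; apply: Rintegral_ge0 => t _.
  exact: (C1 t x x0).1.
rewrite third_order_integral//; apply: Rintegral_ge0 => t _.
exact: (C1 t x x0).2.
Qed.

Lemma pressure_integrable x : 0 < x -> mu.-integrable setT (EFin \o p^~ x).
Proof. by have [+ _] := fam; exact. Qed.

(** If the integrated pressure is unbounded, (a) holds by monotonicity.
    Otherwise almost every member is bounded, hence satisfies (b), and (b) is
    linear. *)
Lemma condC2_integral : (forall t, condC2 (p t)) -> condC2 P.
Proof.
move=> C2; have pP := pressure_integral mu0 fam pp.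
have [|Pn] := pselect (P x @[x --> +oo%R] --> +oo%R); first by left.
right.
have [M PM] : exists M, forall x, 1 <= x -> P x <= M.
  apply: contrapT => /forallNP noM; apply: Pn; apply/cvgryPge => A.
  have /existsNP[x /not_implyP[x1 /negP]] := noM A; rewrite -ltNge => /ltW PA.
  near=> y; apply: (le_trans PA); apply: (pressure_le pP).
    exact: lt_le_trans x1.
  by near: y; exact: nbhs_pinfty_ge (num_real x).
have int1n (n : nat) : mu.-integrable setT (EFin \o p^~ n.+1%:R).
  by apply: pressure_integrable; rewrite ltr0n.
pose h n t := p t n.+1%:R - p t 1.
have ih n : mu.-integrable setT (EFin \o h n).
  exact: (integrableB measurableT (int1n n) (int1n 0)).
have : mu.-negligible [set t | forall B, exists n, B < h n t].
  apply: (@monotone_bounded_ae _ _ _ _ h (M - P 1) ih) => [n t|t m n mn|n].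
  - by rewrite subr_ge0 (pressure_le (pp t))// ler1n.
  - by rewrite lerB// (pressure_le (pp t))// ler_nat.
  - rewrite RintegralB//; last exact: (int1n 0).
    by rewrite lerB// PM// ler1n.
move=> bdd x x0; rewrite -subr_ge0.
have intx : mu.-integrable setT
    (EFin \o (fun t => (- x^-1) * p t x + (-1) * derive1 (p t) x)).
  by apply: intD; apply: intZ; [exact: pressure_integrable|exact: int1].
have -> : - (P x / x) - derive1 P x =
    (\int[mu]_t ((- x^-1) * p t x + (-1) * derive1 (p t) x))%R.
  rewrite RintegralD; [|exact: measurableT|exact/intZ/pressure_integrable|exact/intZ/int1].
  rewrite (RintegralZl _ _ (pressure_integrable x0)); last exact: measurableT.
  rewrite (RintegralZl _ _ (int1 x0)); last exact: measurableT.
  by rewrite -(dpressure_integral fam pp x0) mulN1r mulNr mulrC.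
apply: (Rintegral_ae_ge0 intx); apply: negligibleS bdd => t /= neg B.
have [/cvgryPge py|/(_ x x0)] := C2 t; last first.
  by move=> le; move: neg; rewrite mulN1r mulNr mulrC ltNge subr_ge0 le.
have [X [_ PX]] := py (B + p t 1 + 1).
have [n Xn] : exists n : nat, X < n.+1%:R.
  exists (Num.bound `|X|); apply: (le_lt_trans (ler_norm _)).
  apply: lt_trans (archi_boundP (normr_ge0 X)) _.
  by rewrite ltr_nat ltnS leqnn.
exists n; rewrite /h ltrBrDr; apply: lt_le_trans (PX _ Xn).
by rewrite ltrDl.
Unshelve. all: by end_near. Qed.

(** The limits of x^2 p_t'(x), respectively x^(2 eta) p_t'(x), are integrated
    over t by dominated convergence.  The integral of these nonnegative limits
    is positive as soon as they are positive on a non-null set; if eta = 0 and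
    the integral vanishes, almost every member is of type (b)(i). *)
Lemma condC3_integral : (forall t, condC1 (p t)) -> (forall t, condC3 (p t)) ->
  uniform_at_vacuum mu p -> condC3 P.
Proof.
move=> C1 C3; have pP := pressure_integral mu0 fam pp.
move=> [nonneg|[eta [/andP[eta0 eta1] [g ig gp] full]]].
  have /choice[l lP] : forall t, exists l : R, [/\ 0 <= l,
      forall x, 0 < x -> l <= x ^+ 2 * derive1 (p t) x &
      x ^+ 2 * derive1 (p t) x @[x --> 0^'+] --> l].
    move=> t; have [l [l0 l_le] cl] := sqr_impedance_cvg (pp t) (fun y y0 => (C1 t y y0).1).
    by exists l.
  have [||||il cI] := @cvg_Rintegral_right0 _ _ _ mu
    (fun x t => x ^+ 2 * derive1 (p t) x) l (fun t => derive1 (p t) 1).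
  - by move=> x /andP[x0 _]; exact/intZ/int1.
  - exact: int1.
  - move=> t x /andP[x0 x1]; rewrite ger0_norm; last first.
      by rewrite mulr_ge0 ?sqr_ge0// ltW// dpressure_gt0.
    have := sqr_impedance_nondecreasing (pp t) (fun y y0 => (C1 t y y0).1) x0 x1.
    by rewrite expr1n mul1r.
  - by move=> t; have [] := lP t.
  left; apply/(condC3a_sqr_impedance pP (L := (\int[mu]_t l t)%R)).
    apply: cvg_eq_right0 cI => x x0.
    by rewrite (dpressure_integral fam pp x0) RintegralZl//; exact: int1.
  have l0 t : 0 <= l t by have [] := lP t.
  rewrite lt_neqAle Rintegral_ge0 ?andbT//; apply/eqP => /esym Il0.
  apply: nonneg; apply: negligibleS (Rintegral_eq0 il l0 Il0) => t /=.
  by have [_ _ cl] := lP t; move=> /(condC3a_sqr_impedance (pp t) cl).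
have /choice[l lP] : forall t, exists l : R, [/\ 0 <= l,
    x `^ (2 * eta) * derive1 (p t) x @[x --> 0^'+] --> l &
    eta = 0 -> l = 0 -> condC3b1 (p t)].
  move=> t; apply: (bounded_order_cvg (pp t) (C1 t) (C3 t) _ (gp t)).
  by rewrite eta0.
have l0 t : 0 <= l t by have [] := lP t.
have [||||il cI] := @cvg_Rintegral_right0 _ _ _ mu
  (fun x t => x `^ (2 * eta) * derive1 (p t) x) l g.
- by move=> x /andP[x0 _]; exact/intZ/int1.
- exact: ig.
- move=> t x /[dup] x01 /andP[x0 x1]; rewrite ger0_norm ?gp//.
  by rewrite mulr_ge0 ?powR_ge0// ltW// dpressure_gt0.
- by move=> t; have [] := lP t.
have cP : x `^ (2 * eta) * derive1 P x @[x --> 0^'+] --> (\int[mu]_t l t)%R.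
  apply: cvg_eq_right0 cI => x x0.
  by rewrite (dpressure_integral fam pp x0) RintegralZl//; exact: int1.
have : 0 <= (\int[mu]_t l t)%R by apply: Rintegral_ge0.
rewrite le_eqVlt => /predU1P[/esym Il0|Ilgt0]; apply/(condC3E pP); last first.
  by apply: Or33; exists eta; rewrite ?eta0//; exists (\int[mu]_t l t)%R.
have l_null := Rintegral_eq0 il l0 Il0.
case: full => [eta_0|full]; last first.
  exfalso; apply: full; apply: negligibleS l_null => t /= /(sound_speed_orderE (pp t)).
  move=> [L L0 cL]; have [_ cl _] := lP t.
  by rewrite -(cvg_unique (@Rhausdorff R) cL cl).
apply: Or32; split.
  apply/(cvg_dpressure0 pP)/powR0_dpressureE.
  by move: cP; rewrite eta_0 Il0.
move=> x x0.
have -> : 2 * derive1 P x - x * derive1n 2 P x =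
    2 * derive1 P x + (- x) * derive1n 2 P x by rewrite mulNr.
rewrite (second_order_integral _ _ x0).
apply: (Rintegral_ae_ge0 (second_order_integrable _ _ x0)).
apply: negligibleS l_null => t /= neg.
have [_ _ b1] := lP t; rewrite lt_neqAle l0 andbT; apply/eqP => /esym lt0.
have [_ /(_ x x0)] := b1 eta_0 lt0; move: neg; rewrite mulNr ltNge.
by move=> /negP.
Qed.

End FamilyConditions.

(** * The reverse Minkowski inequality and Riemann sums *)

Lemma le_limn_einf {R : realType} (u : (\bar R)^nat) (z : \bar R) :
  (\forall n \near \oo, (z <= u n)%E) -> (z <= limn_einf u)%E.
Proof.
move=> [N _ zu]; rewrite limn_einf_lim; apply: lime_ge; first exact: is_cvg_einfs.
near=> n; apply: le_ereal_inf_tmp => _ [k /= nk <-]; apply: zu => /=.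
by apply: leq_trans nk; near: n; exact: nbhs_infty_ge.
Unshelve. all: by end_near. Qed.

Lemma limn_einf_le {R : realType} (u : (\bar R)^nat) (z : \bar R) :
  (\forall n \near \oo, (u n <= z)%E) -> (limn_einf u <= z)%E.
Proof.
move=> uz; rewrite limn_einf_lim; apply: lime_le; first exact: is_cvg_einfs.
apply: filterS uz => n; apply: le_trans; apply: ereal_inf_lbound.
by exists n => //=.
Qed.

Lemma measurable_fun_limn_einf {R : realType} (d : measure_display)
    (T : measurableType d) (f : (T -> \bar R)^nat) :
  (forall n, measurable_fun setT (f n)) ->
  measurable_fun setT (fun t => limn_einf (f^~ t)).
Proof.
move=> mf.
apply: (measurableT_comp (f := fun z : \bar R => (- z)%E)); first exact: oppe_measurable.
apply: (measurable_fun_limn_esup (f := fun n t => (- f n t)%E)) => n.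
by apply: (measurableT_comp (f := fun z : \bar R => (- z)%E)); first exact: oppe_measurable.
Qed.

(** Cauchy-Schwarz in Sedrakyan's form: the weighted variance
    sum_i (a_i - h_i A / S)^2 / h_i, with A and S the sums of the a_i and h_i, is
    nonnegative. *)
Lemma sum_sqr_le {R : realType} (n : nat) (a h : 'I_n -> R) : (forall i, 0 < h i) ->
  (\sum_i a i) ^+ 2 <= (\sum_i h i) * \sum_i (a i ^+ 2 / h i).
Proof.
case: n a h => [|n] a h h0; first by rewrite !big_ord0 expr0n mulr0.
set A := \sum_i a i; set S := \sum_i h i; set Q := \sum_i _.
have S0 : 0 < S by rewrite /S big_ord_recl ltr_pwDl// sumr_ge0// => i _; exact: ltW.
have : 0 <= \sum_i (a i - h i * (A / S)) ^+ 2 / h i.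
  by apply: sumr_ge0 => i _; rewrite divr_ge0 ?sqr_ge0// ltW.
have -> : \sum_i (a i - h i * (A / S)) ^+ 2 / h i =
    \sum_i (a i ^+ 2 / h i + (- 2 * (A / S)) * a i + (A / S) ^+ 2 * h i).
  apply: eq_bigr => i _; move: (h0 i) => /lt0r_neq0 hi.
  by move: (A / S) => k; field.
rewrite !big_split /= -!mulr_sumr -/A -/S -/Q => var_ge0.
rewrite -ler_pdivrMl//; move: var_ge0.
have -> : Q + - 2 * (A / S) * A + (A / S) ^+ 2 * S = Q - S^-1 * A ^+ 2.
  by field; rewrite gt_eqF.
by rewrite subr_ge0.
Qed.

Section RiemannSums.
Context {R : realType} (p : R -> R) (pp : pressure p).
Hypothesis C1 : condC1 p.
Local Notation c := (sound_speed p).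
Local Notation rar := (rarefaction_integral p).
Local Notation K := (rarefaction_primitive p).

Let C1l (x : R) (x0 : 0 < x) := (C1 x0).1.

Lemma is_derive_scale_inv (k s : R) : 0 < s ->
  is_derive s 1 (fun x => - k * x^-1) (k * s ^- 2).
Proof.
move=> s0; apply: (is_derive_eq (is_derive_scale (- k) (is_derive_inv s0))).
by rewrite mulrNN.
Qed.

Lemma rarefaction_integrandE (s : R) : 0 < s -> c s / s = s * c s * s ^- 2.
Proof. by move=> s0; move: (c s) => cs; field; rewrite gt_eqF. Qed.

Lemma rarefaction_integral_ge (a b k : R) : 0 < a -> a <= b ->
  (forall s, a <= s <= b -> k <= s * c s) -> k * (a^-1 - b^-1) <= K b - K a.
Proof.
move=> a0 ab kc; rewrite -rarefaction_integralE//.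
have -> : k * (a^-1 - b^-1) = - k * b^-1 - - k * a^-1 by ring.
apply: (rarefaction_ge pp (F := fun x => - k * x^-1) (f := fun x => k * x ^- 2)) => //.
  by move=> s /andP[as_ _]; exact/is_derive_scale_inv/(lt_le_trans a0).
move=> s /[dup] /kc kcs /andP[/(lt_le_trans a0) s0 _]; rewrite rarefaction_integrandE//.
by rewrite ler_wpM2r ?invr_ge0 ?sqr_ge0.
Qed.

Lemma rarefaction_integral_le (a b k : R) : 0 < a -> a <= b ->
  (forall s, a <= s <= b -> s * c s <= k) -> K b - K a <= k * (a^-1 - b^-1).
Proof.
move=> a0 ab kc.
have : - k * a^-1 + - K a <= - k * b^-1 + - K b.
  apply: (is_derive_ge0_le (f := fun x => - k * x^-1 + - K x)
    (df := fun x => k * x ^- 2 + - (c x / x)) ab).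
    move=> s /andP[/(lt_le_trans a0) s0 _].
    exact: is_derive_add (is_derive_scale_inv k s0)
      (is_derive_opp (rarefaction_primitive_is_derive pp s0)).
  move=> s /[dup] /kc kcs /andP[/(lt_le_trans a0) s0 _]; rewrite rarefaction_integrandE// subr_ge0.
  by rewrite ler_wpM2r ?invr_ge0 ?sqr_ge0.
have -> : k * (a^-1 - b^-1) = - k * b^-1 - - k * a^-1 by ring.
move: (K a) (K b) (- k * a^-1) (- k * b^-1) => u v w z.
by clear; lra.
Qed.

(** In the variable v = 1 / s the integrand is the monotone function s c(s), so
    the integral lies between its two one-step Riemann sums. *)
Lemma rarefaction_integral_bounds (a b : R) : 0 < a -> a <= b ->
  a * c a * (a^-1 - b^-1) <= K b - K a <= b * c b * (a^-1 - b^-1).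
Proof.
move=> a0 ab; apply/andP; split.
  apply: rarefaction_integral_ge => // s /andP[as_ _].
  exact: impedance_nondecreasing.
apply: rarefaction_integral_le => // s /andP[/(lt_le_trans a0) s0 sb].
exact: impedance_nondecreasing.
Qed.

(** Uniform in the specific volume: 1 / grid r n i increases from 1 / r in steps
    of 1 / (n + 1). *)
Definition grid (r : R) (n i : nat) : R := (r^-1 + i%:R / n.+1%:R)^-1.

Lemma gridV r n i : (grid r n i)^-1 = r^-1 + i%:R / n.+1%:R.
Proof. exact: invrK. Qed.

Lemma grid_gt0 r n i : 0 < r -> 0 < grid r n i.
Proof. by move=> r0; rewrite invr_gt0 ltr_pwDl ?invr_gt0// divr_ge0. Qed.

Lemma grid0 r n : grid r n 0 = r.
Proof. by rewrite /grid mul0r addr0 invrK. Qed.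

Lemma grid_step r n i : (grid r n i.+1)^-1 - (grid r n i)^-1 = n.+1%:R^-1.
Proof. by rewrite !gridV -natr1; ring. Qed.

Lemma grid_le r n i : 0 < r -> grid r n i.+1 <= grid r n i.
Proof.
move=> r0; rewrite -lef_pV2 ?posrE ?grid_gt0// -subr_ge0 grid_step.
by rewrite invr_ge0.
Qed.

Definition upper_sum (r : R) (n m : nat) : R :=
  \sum_(i < m) n.+1%:R^-1 * (grid r n i * c (grid r n i)).

(** The upper and lower Riemann sums of a monotone function differ by one step
    times its total variation. *)
Lemma upper_sum_bounds r n m : 0 < r ->
  K r - K (grid r n m) <= upper_sum r n m <=
  K r - K (grid r n m) + n.+1%:R^-1 * (r * c r - grid r n m * c (grid r n m)).
Proof.
move=> r0; rewrite /upper_sum; elim: m => [|m /andP[IH1 IH2]].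
  by rewrite big_ord0 grid0 !subrr mulr0 addr0 lexx.
rewrite big_ord_recr /=.
have /andP[] := rarefaction_integral_bounds (grid_gt0 n m.+1 r0) (grid_le n m r0).
rewrite grid_step; set e := _ * c (grid r n m.+1); set e' := _ * c (grid r n m).
move: IH1 IH2; rewrite -/e'; set u := \sum_(i < m) _; clearbody u e e'.
move: n.+1%:R^-1 (K r) (K (grid r n m)) (K (grid r n m.+1)) (r * c r) => d k0 k1 k2 e0.
by clear; move=> IH1 IH2 h1 h2; apply/andP; split; lra.
Qed.

End RiemannSums.

Section Minkowski.
Context {R : realType} (d : measure_display) (T : measurableType d).
Variable mu : {measure set T -> \bar R}.

(** Minkowski's inequality is reversed in L^(1/2).  With h_i the square root of
    the integral of g_i, [sum_sqr_le] bounds the left integrand by a function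
    that is linear in the g_i, whose integral is (sum_i h_i)^2. *)
Lemma reverse_minkowski (n : nat) (g : 'I_n -> T -> R) :
  (forall i, mu.-integrable setT (EFin \o g i)) -> (forall i t, 0 <= g i t) ->
  (forall i, 0 < (\int[mu]_t g i t)%R) ->
  (\int[mu]_t ((\sum_i Num.sqrt (g i t)) ^+ 2)%:E <=
    ((\sum_i Num.sqrt (\int[mu]_t g i t)%R) ^+ 2)%:E)%E.
Proof.
move=> ig g0 I0; pose h i := Num.sqrt (\int[mu]_t g i t)%R.
have h0 i : 0 < h i by rewrite sqrtr_gt0.
pose S := \sum_i h i; pose f i t := S / h i * g i t.
have intf i : mu.-integrable setT (EFin \o f i).
  exact: (integrableZl measurableT (S / h i) (ig i)).
have msqrt i : measurable_fun setT (fun t => Num.sqrt (g i t)).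
  exact: (measurableT_comp (continuous_measurable_fun (@sqrt_continuous R))
    (integrable_measurable (ig i))).
have mf i : measurable_fun setT (f i) := integrable_measurable (intf i).
apply: (@le_trans _ _ (\int[mu]_t (\sum_i f i t)%:E)%E).
  apply: ge0_le_integral => //.
  - by move=> t _; rewrite lee_fin sqr_ge0.
  - apply/measurable_EFinP; apply: measurable_funX; exact: measurable_sum.
  - by apply/measurable_EFinP; exact: measurable_sum.
  - move=> t _; rewrite lee_fin; apply: (le_trans (sum_sqr_le _ h0)).
    rewrite mulr_sumr ler_sum// => i _.
    by rewrite sqr_sqrtr// /f mulrA mulrAC.
under eq_integral do rewrite -sumEFin.
rewrite (integral_sum measurableT intf).
under eq_bigr => i _ do rewrite -Rintegral_EFin// /f (RintegralZl _ _ (ig i))//.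
rewrite sumEFin lee_fin [leRHS]expr2 -/S [leRHS]mulr_sumr ler_sum// => i _.
rewrite -[X in _ * X](sqr_sqrtr (ltW (I0 i))) -/(h i) expr2 mulrA divfK//.
exact/lt0r_neq0/h0.
Qed.

End Minkowski.

(** * Reaching vacuum with an integrated pressure *)

Section VacuumIntegral.
Context {R : realType} (d : measure_display) (T : measurableType d).
Variables (mu : {measure set T -> \bar R}) (p : T -> R -> R).
Hypotheses (mu0 : mu setT != 0%E) (fam : integrable_family mu p).
Hypothesis pp : forall t, pressure (p t).
Hypothesis C1 : forall t, condC1 (p t).
Local Notation P := (integral_pressure mu p).

Lemma upper_sum_sqrt (q : R -> R) (r : R) (n m : nat) : 0 < r ->
  upper_sum q r n m =
  \sum_(i < m) Num.sqrt ((n.+1%:R^-1 * grid r n i) ^+ 2 * derive1 q (grid r n i)).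
Proof.
move=> r0; apply: eq_bigr => i _; rewrite sqrtrM ?sqr_ge0// sqrtr_sqr ger0_norm.
  by rewrite mulrA.
by apply: mulr_ge0; [rewrite invr_ge0|exact/ltW/grid_gt0].
Qed.

Lemma weighted_dpressure_integrable (k x : R) : 0 < x ->
  mu.-integrable setT (EFin \o (fun t => k * derive1 (p t) x)).
Proof.
by move=> x0; exact: (integrableZl measurableT k (dpressure_integrable fam pp x0)).
Qed.

Lemma weighted_dpressure_integral (k x : R) : 0 < x ->
  (\int[mu]_t (k * derive1 (p t) x))%R = k * derive1 P x.
Proof.
move=> x0; rewrite (dpressure_integral fam pp x0) RintegralZl//.
exact: (dpressure_integrable fam pp x0).
Qed.

Lemma upper_sum_integral (r : R) (n m : nat) : 0 < r ->
  (\int[mu]_t (upper_sum (p t) r n m ^+ 2)%:E <= (upper_sum P r n m ^+ 2)%:E)%E.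
Proof.
move=> r0; have pP := pressure_integral mu0 fam pp.
under eq_integral do rewrite upper_sum_sqrt//.
rewrite upper_sum_sqrt//.
have -> : \sum_(i < m) Num.sqrt ((n.+1%:R^-1 * grid r n i) ^+ 2 * derive1 P (grid r n i))
    = \sum_(i < m) Num.sqrt
        (\int[mu]_t ((n.+1%:R^-1 * grid r n i) ^+ 2 * derive1 (p t) (grid r n i)))%R.
  by apply: eq_bigr => i _; rewrite weighted_dpressure_integral// grid_gt0.
apply: reverse_minkowski => [i|i t|i].
- exact/weighted_dpressure_integrable/grid_gt0.
- by rewrite mulr_ge0 ?sqr_ge0// ltW// dpressure_gt0// grid_gt0.
- rewrite weighted_dpressure_integral ?grid_gt0// mulr_gt0//.
    by apply/exprn_gt0/mulr_gt0; [rewrite invr_gt0 ltr0n|exact: grid_gt0].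
  by rewrite dpressure_gt0// grid_gt0.
Qed.

Lemma upper_sum_measurable (r : R) (n m : nat) : 0 < r ->
  measurable_fun setT (fun t => upper_sum (p t) r n m).
Proof.
move=> r0; apply: measurable_sum => i; apply: measurable_funM => //.
apply: measurable_funM => //.
apply: (measurableT_comp (continuous_measurable_fun (@sqrt_continuous R))).
exact: integrable_measurable (dpressure_integrable fam pp (grid_gt0 n i r0)).
Qed.

(** Suppose that the rarefaction integrals of P from any a to r stay below some
    y < c_P(r).  Then the upper Riemann sums of P are eventually at most a fixed
    y' < c_P(r).  By [reverse_minkowski] the squared sums of the members have
    integral at most y'^2, while their lower limit is at least
    c_t(r)^2 = p_t'(r); Fatou's lemma yields c_P(r)^2 <= y'^2. *)
Lemma vacuum_reachable_integral : (forall t, vacuum_reachable (p t)) ->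
  vacuum_reachable P.
Proof.
move=> vac r y r0 yc; have pP := pressure_integral mu0 fam pp.
have CP := condC1_integral fam pp C1.
apply: contrapT => /forall2NP noa.
have rar_le a : 0 < a -> a < r -> rarefaction_integral P a r <= y.
  move=> a0 ar; have [/negP|/negP] := noa a; first by rewrite a0 ar.
  by rewrite -leNgt.
pose C := sound_speed P r; pose y' := (y + C) / 2.
have [yy' y'C] : y < y' /\ y' < C by rewrite /y'; split; move: yc; rewrite -/C; lra.
(* With (n+1)^2 steps of length 1/(n+1), the grid reaches the volume 1/r + n + 1,
   so that it becomes finer and longer at the same time. *)
pose N n := (n.+1 * n.+1)%N; pose a n := grid r n (N n).
have a0 n : 0 < a n by exact: grid_gt0.
have aV n : (a n)^-1 = r^-1 + n.+1%:R.
  by rewrite gridV natrM mulfK// pnatr_eq0.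
have ar n : a n < r by rewrite -ltf_pV2// ?posrE// aV ltrDl ltr0n.
have y0 : 0 <= y.
  apply: le_trans (rar_le _ (a0 0) (ar 0)).
  by rewrite rarefaction_integralE ?subr_ge0 ?rarefaction_primitive_le ?(ltW (ar 0)).
pose f n t := (upper_sum (p t) r n (N n) ^+ 2)%:E.
have mf n : measurable_fun setT (f n).
  apply/measurable_EFinP; apply: measurable_funX; exact: upper_sum_measurable.
have f0 n t : (0 <= f n t)%E by rewrite lee_fin sqr_ge0.
have upper : (limn_einf (fun n => \int[mu]_t f n t) <= (y' ^+ 2)%:E)%E.
  apply: limn_einf_le; near=> n; apply: (le_trans (upper_sum_integral n (N n) r0)).
  have /andP[lo up] := upper_sum_bounds pP CP n (N n) r0.
  have rarE : rarefaction_integral P (a n) r =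
      rarefaction_primitive P r - rarefaction_primitive P (a n).
    by rewrite rarefaction_integralE// ltW.
  have rar0 : 0 <= rarefaction_primitive P r - rarefaction_primitive P (a n).
    by rewrite subr_ge0 rarefaction_primitive_le// ltW.
  have U0 : 0 <= upper_sum P r n (N n) by exact: le_trans lo.
  rewrite lee_fin ler_sqr ?nnegrE ?(le_trans y0 (ltW yy'))//.
  apply: (le_trans up); rewrite -/(a n) -rarE.
  have -> : y' = y + (y' - y) by rewrite addrC subrK.
  apply: lerD; first exact: rar_le.
  have y'y : 0 < y' - y by rewrite subr_gt0.
  apply: (@le_trans _ _ (n.+1%:R^-1 * (r * C))).
    rewrite ler_wpM2l ?invr_ge0// gerBl mulr_ge0 ?sqrtr_ge0// ltW//.
  rewrite ler_pdivrMl ?ltr0n// -ler_pdivrMr//.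
  apply: (@le_trans _ _ n%:R); last by rewrite ler_nat.
  by near: n; exact: nbhs_infty_ger.
have lower t : ((derive1 (p t) r)%:E <= limn_einf (f^~ t))%E.
  apply/lee_subgt0Pr => e e0; rewrite -EFinB; set z := _ - e.
  have zc : Num.sqrt z < sound_speed (p t) r.
    by rewrite ltr_sqrt ?dpressure_gt0// /z ltrBlDr ltrDl.
  have [b /andP[b0 br] zb] := vac t r _ r0 zc.
  apply: le_limn_einf; near=> n.
  have anb : a n <= b.
    rewrite -lef_pV2// ?posrE// aV; apply: (@le_trans _ _ n%:R).
      by near: n; exact: nbhs_infty_ger.
    by rewrite -natr1 addrCA lerDl addr_ge0// invr_ge0 ltW.
  have /andP[lo _] := upper_sum_bounds (pp t) (C1 t) n (N n) r0.
  have zU : Num.sqrt z <= upper_sum (p t) r n (N n).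
    apply: le_trans lo; apply: (le_trans (ltW zb)).
    rewrite rarefaction_integralE// ?(ltW br)// lerB//.
    exact: (rarefaction_primitive_le (pp t) (a0 n) anb).
  rewrite lee_fin; have [z0|/ltW z0] := leP 0 z; last exact: le_trans (sqr_ge0 _).
  by rewrite -{1}(sqr_sqrtr z0) ler_sqr ?nnegrE ?sqrtr_ge0// (le_trans (sqrtr_ge0 z)).
have : (\int[mu]_t (derive1 (p t) r)%:E <= (y' ^+ 2)%:E)%E.
  apply: le_trans upper; apply: le_trans (fatou mu measurableT mf _); last by [].
  apply: ge0_le_integral => //.
  - by move=> t _; rewrite lee_fin ltW// dpressure_gt0.
  - exact: measurable_int (dpressure_integrable fam pp r0).
  - exact: measurable_fun_limn_einf.
rewrite -(Rintegral_EFin (dpressure_integrable fam pp r0)).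
rewrite -(dpressure_integral fam pp r0) lee_fin -sqr_sound_speed// ler_sqr ?nnegrE.
- by rewrite leNgt y'C.
- exact: sqrtr_ge0.
- by rewrite (le_trans y0)// ltW.
Unshelve. all: by end_near. Qed.

End VacuumIntegral.

Theorem propositionC (R : realType) :
  [/\ (forall p : R -> R, pressure p ->
         condC1 p -> condC2 p -> condC3 p -> Riemann_well_posed p),
      [/\ convex_cone [set p : R -> R | pressure p /\ condC1 p],
          convex_cone [set p : R -> R | pressure p /\ condC2 p],
          convex_cone [set p : R -> R | pressure p /\ condC3 p] &
          convex_cone [set p : R -> R | admissible p]] &
      (forall (d : measure_display) (T : measurableType d)
              (mu : {measure set T -> \bar R}) (p : T -> R -> R),
         mu setT != 0%E ->
         (forall t : T, admissible (p t)) ->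
         integrable_family mu p ->
         [/\ pressure (integral_pressure mu p),
             condC1 (integral_pressure mu p),
             condC2 (integral_pressure mu p),
             uniform_at_vacuum mu p -> condC3 (integral_pressure mu p) &
             Riemann_well_posed (integral_pressure mu p)])].
Proof.
split=> [p pp C1 _ C3||d T mu p mu0 adm fam].
- have C1l (x : R) (x0 : 0 < x) := (C1 x x0).1.
  apply: (Riemann_well_posed_of_vacuum_reachable pp C1l).
  exact: vacuum_reachable_of_C3.
- split; [exact: convex_cone_C1|exact: convex_cone_C2|exact: convex_cone_C3|].
  exact: convex_cone_admissible.
have pp t : pressure (p t) by have [] := adm t.
have C1 t : condC1 (p t) by have [] := adm t.
have C2 t : condC2 (p t) by have [] := adm t.
have C3 t : condC3 (p t) by have [] := adm t.
have pP := pressure_integral mu0 fam pp.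
have CP := condC1_integral fam pp C1.
split; [exact: pP|exact: CP|exact: condC2_integral|exact: condC3_integral|].
have CP' (x : R) (x0 : 0 < x) := (CP x x0).1.
apply: (Riemann_well_posed_of_vacuum_reachable pP CP').
apply: vacuum_reachable_integral => // t.
exact: vacuum_reachable_of_C3 (pp t) (fun x x0 => (C1 t x x0).1) (C3 t).
Qed.
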